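(* Let $p$ be a prime and let $\mathcal{F}$ be a constrained saturated fusion system over a finite $p$-group $S$. Then there exists a unique (up to isomorphism) $p'$-reduced $p$-constrained finite group $G$, with $S$ a Sylow $p$-subgroup of $G$, such that $\mathcal{F}=\mathcal{F}_S(G)$.
   Context: For subgroups $P,Q$ of a group $G$: $c_x$ denotes conjugation $g\mapsto xgx^{-1}$; $\mathrm{Hom}_G(P,Q)$ is the set of homomorphisms $P\to Q$ induced by conjugation by elements of $G$; $\mathrm{Aut}_G(P)=\mathrm{Hom}_G(P,P)$; $\mathrm{Inj}(P,Q)$ is the set of injective homomorphisms. A fusion system $\mathcal{F}$ over a finite $p$-group $S$ is a category whose objects are all subgroups of $S$, whose morphisms are group homomorphisms, such that for all $P,Q\le S$: $\mathrm{Hom}_S(P,Q)\subseteq \mathrm{Hom}_{\mathcal{F}}(P,Q)\subseteq \mathrm{Inj}(P,Q)$, and each $\varphi\in\mathrm{Hom}_{\mathcal{F}}(P,Q)$ is the composite of an isomorphism in $\mathcal{F}$ followed by an inclusion. $\mathrm{Aut}_{\mathcal{F}}(P)=\mathrm{Hom}_{\mathcal{F}}(P,P)$. Subgroups are $\mathcal{F}$-conjugate if isomorphic in $\mathcal{F}$. $P$ is $\mathcal{F}$-centric if $C_S(P')=Z(P')$ for all $P'$ $\mathcal{F}$-conjugate to $P$. $P$ is fully centralized (fully normalized) if $|C_S(P)|\ge|C_S(P')|$ ($|N_S(P)|\ge|N_S(P')|$) for all $P'$ $\mathcal{F}$-conjugate to $P$. $\mathcal{F}$ is saturated if for all $P\le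 S$: (I) if $P$ is fully normalized then $P$ is fully centralized and $\mathrm{Aut}_S(P)\in\mathrm{Syl}_p(\mathrm{Aut}_{\mathcal{F}}(P))$; (II) if $\varphi\in\mathrm{Hom}_{\mathcal{F}}(P,S)$ and $\varphi(P)$ is fully centralized, then $\varphi$ extends to some $\overline\varphi\in\mathrm{Hom}_{\mathcal{F}}(N_\varphi,S)$, where $N_\varphi=\{g\in N_S(P)\mid \varphi c_g\varphi^{-1}\in\mathrm{Aut}_S(\varphi(P))\}$. A normal subgroup $Q\trianglelefteq S$ is normal in $\mathcal{F}$ if each $\alpha\in\mathrm{Hom}_{\mathcal{F}}(P,P')$ extends to some $\overline{\alpha}\in\mathrm{Hom}_{\mathcal{F}}(PQ,P'Q)$ with $\overline{\alpha}(Q)=Q$. A saturated fusion system $\mathcal{F}$ over $S$ is constrained if there is some $Q\trianglelefteq S$ which is $\mathcal{F}$-centric and normal in $\mathcal{F}$. For a finite group $G$ with Sylow $p$-subgroup $S$, $\mathcal{F}_S(G)$ is the category whose objects are all subgroups of $S$ and with $\mathrm{Hom}_{\mathcal{F}_S(G)}(P,Q)=\mathrm{Hom}_G(P,Q)$. A finite group $G$ is $p'$-reduced if it has no nontrivial normal subgroup of order prime to $p$. A $p'$-reduced finite group $G$ is $p$-constrained if there is a normal $p$-subgroup $P\trianglelefteq G$ with $C_G(P)\le P$. *)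

(* Defs.v *)
From mathcomp Require Import all_boot all_fingroup all_solvable.

Set Implicit Arguments.
Unset Strict Implicit.
Unset Printing Implicit Defensive.

Local Open Scope group_scope.

(* A morphism with source P is represented by a function f : gT -> gT of which
   only the restriction to P matters (see [hom_ext] below).  MathComp's [g ^ y]
   is y^-1 g y, so that c_x : g |-> x g x^-1 is written [conjg^~ x^-1]. *)

Definition conj_hom (gT : finGroupType) (G P Q : {set gT}) (f : gT -> gT) : bool :=
  [exists x in G, [forall g in P, (f g == g ^ x^-1) && (f g \in Q)]].

Definition iso_in (gT : finGroupType)
    (hom : {group gT} -> {group gT} -> pred (gT -> gT))
    (P Q : {group gT}) (f : gT -> gT) : Prop :=
  hom P Q f /\
  exists g, [/\ hom Q P g, {in P, cancel f g} & {in Q, cancel g f}].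

(* The objects are the subgroups of S: the values of [hom] on other subgroups
   of gT are irrelevant and never used. *)
Record fusion_system (gT : finGroupType) (S : {group gT}) := FusionSystem {
  hom :> {group gT} -> {group gT} -> pred (gT -> gT);
  hom_ext : forall (P Q : {group gT}) f g, P \subset S -> Q \subset S ->
    {in P, f =1 g} -> hom P Q f = hom P Q g;
  hom_id : forall P : {group gT}, P \subset S -> hom P P id;
  hom_comp : forall (P Q R : {group gT}) f g,
    P \subset S -> Q \subset S -> R \subset S ->
    hom P Q f -> hom Q R g -> hom P R (g \o f);
  hom_conj : forall (P Q : {group gT}) f, P \subset S -> Q \subset S ->
    conj_hom S P Q f -> hom P Q f;
  hom_inj : forall (P Q : {group gT}) f, P \subset S -> Q \subset S ->
    hom P Q f ->
    [/\ {in P &, {morph f : x y / x * y}}, {in P &, injective f}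
      & {in P, forall x, f x \in Q}];
  (* composing with an inclusion does not change the underlying function *)
  hom_factor : forall (P Q : {group gT}) f, P \subset S -> Q \subset S ->
    hom P Q f -> exists2 R : {group gT}, R \subset Q & iso_in hom P R f
}.

(* Automorphisms of P are the permutations of gT in MathComp's [Aut P] (those
   fixing every element outside P).  Products of permutations are composed from
   left to right, which changes neither subgroups nor their orders. *)
Definition AutF (gT : finGroupType) (S : {group gT}) (F : fusion_system S)
    (P : {group gT}) : {set {perm gT}} :=
  [set a in Aut P | F P P a].

Definition AutG (gT : finGroupType) (G P : {set gT}) : {set {perm gT}} :=
  [set a in Aut P | conj_hom G P P a].

Lemma AutF_group_set (gT : finGroupType) (S : {group gT})
    (F : fusion_system S) (P : {group gT}) :
  P \subset S -> group_set (AutF F P).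
Proof.
move=> sPS; apply/group_setP; split=> [|a b].
  apply/setIdP; rewrite group1; split=> //; rewrite (@hom_ext _ _ F P P _ id) ?hom_id //.
  by move=> x _; rewrite /= perm1.
case/setIdP=> [Aa Fa] /setIdP[Ab Fb]; apply/setIdP; rewrite groupM //; split=> //.
rewrite (@hom_ext _ _ F P P _ (b \o a)) //; first exact: (@hom_comp _ _ F P P P).
by move=> x _; rewrite /= permM.
Qed.

Lemma AutG_group_set (gT : finGroupType) (G P : {group gT}) :
  group_set (AutG G P).
Proof.
apply/group_setP; split=> [|a b].
  apply/setIdP; rewrite group1; split=> //; apply/exists_inP; exists 1; rewrite ?group1 //.
  by apply/forall_inP=> g Pg; rewrite perm1 invg1 conjg1 eqxx.
case/setIdP=> [Aa /exists_inP[x Gx /forall_inP Ha]].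
case/setIdP=> [Ab /exists_inP[y Gy /forall_inP Hb]].
apply/setIdP; rewrite groupM //; split=> //.
apply/exists_inP; exists (y * x); rewrite ?groupM //.
apply/forall_inP=> g Pg; have /andP[/eqP Ea Pa] := Ha g Pg.
have /andP[/eqP Eb Pb] := Hb _ Pa.
by rewrite permM Pb andbT Eb Ea -conjgM invMg.
Qed.

Canonical AutG_group (gT : finGroupType) (G P : {group gT}) :=
  group (AutG_group_set G P).

Section FusionNotions.

Variables (gT : finGroupType) (S : {group gT}) (F : fusion_system S).

Definition fconj (P P' : {group gT}) : Prop := exists f, iso_in F P P' f.

Definition centric (P : {group gT}) : Prop :=
  forall P' : {group gT}, P' \subset S -> fconj P P' -> 'C_S(P') = 'Z(P').

Definition fully_centralized (P : {group gT}) : Prop :=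
  forall P' : {group gT}, P' \subset S -> fconj P P' -> #|'C_S(P')| <= #|'C_S(P)|.

Definition fully_normalized (P : {group gT}) : Prop :=
  forall P' : {group gT}, P' \subset S -> fconj P P' -> #|'N_S(P')| <= #|'N_S(P)|.

(* phi c_g phi^-1 = a on phi(P) is written phi o c_g = a o phi on P *)
Definition Nphi (P : {group gT}) (phi : {morphism P >-> gT}) : {set gT} :=
  [set g in 'N_S(P) | [exists a in AutG S (phi @* P),
    [forall x in P, phi (x ^ g^-1) == a (phi x)]]].

Lemma Nphi_group_set (P : {group gT}) (phi : {morphism P >-> gT}) :
  group_set (Nphi phi).
Proof.
apply/group_setP; split=> [|g h].
  apply/setIdP; rewrite group1; split=> //; apply/exists_inP; exists 1; rewrite ?group1 //.
  by apply/forall_inP=> x Px; rewrite perm1 invg1 conjg1.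
case/setIdP=> [Ng /exists_inP[a Aa /forall_inP Ha]].
case/setIdP=> [Nh /exists_inP[b Ab /forall_inP Hb]].
apply/setIdP; rewrite groupM //; split=> //; apply/exists_inP; exists (b * a); rewrite ?groupM //.
apply/forall_inP=> x Px; rewrite invMg conjgM permM -(eqP (Hb x Px)) Ha //.
by rewrite memJ_norm // groupV; case/setIP: Nh.
Qed.

Canonical Nphi_group (P : {group gT}) (phi : {morphism P >-> gT}) :=
  group (Nphi_group_set phi).

(* By [hom_inj], every member of Hom_F(P, S) is a morphism, so quantifying over
   {morphism P >-> gT} in the second condition is no restriction. *)
Definition saturated (p : nat) : Prop :=
  (forall P : {group gT}, P \subset S -> fully_normalized P ->
     fully_centralized P /\ p.-Sylow(AutF F P) (AutG S P)) /\
  (forall (P : {group gT}) (phi : {morphism P >-> gT}), P \subset S ->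
     F P S phi -> fully_centralized (phi @* P)%G ->
     exists2 psi, F (Nphi_group phi) S psi & {in P, psi =1 phi}).

(* For Q normal in S, the join P <*> Q is the product PQ. *)
Definition normal_in (Q : {group gT}) : Prop :=
  Q <| S /\
  forall (P P' : {group gT}) alpha, P \subset S -> P' \subset S -> F P P' alpha ->
    exists beta, [/\ F (P <*> Q)%G (P' <*> Q)%G beta, {in P, beta =1 alpha}
                   & beta @: Q = Q].

Definition constrained : Prop :=
  exists Q : {group gT}, [/\ Q <| S, centric Q & normal_in Q].

End FusionNotions.

Section FusionOfGroup.

Variables (gT : finGroupType) (G T : {group gT}) (sTG : T \subset G).

Let homG (P Q : {group gT}) : pred (gT -> gT) := conj_hom G P Q.

Let homG_P (P Q : {group gT}) f :
  reflect (exists2 x, x \in G & {in P, forall g, f g = g ^ x^-1 /\ f g \in Q})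
          (homG P Q f).
Proof.
apply: (iffP exists_inP) => [[x Gx /forall_inP H]|[x Gx H]]; exists x => //.
  by move=> g /H /andP[/eqP].
by apply/forall_inP=> g /H[/eqP-> ->].
Qed.

Let homG_ext (P Q : {group gT}) f g : P \subset T -> Q \subset T ->
  {in P, f =1 g} -> homG P Q f = homG P Q g.
Proof.
move=> _ _ fg; apply/homG_P/homG_P => -[x Gx H]; exists x => // y Py.
  by rewrite -fg //; apply: H.
by rewrite fg //; apply: H.
Qed.

Let homG_id (P : {group gT}) : P \subset T -> homG P P id.
Proof. by move=> _; apply/homG_P; exists 1; rewrite ?group1 // => g; rewrite invg1 conjg1. Qed.

Let homG_comp (P Q R : {group gT}) f g :
  P \subset T -> Q \subset T -> R \subset T ->
  homG P Q f -> homG Q R g -> homG P R (g \o f).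
Proof.
move=> _ _ _ /homG_P[x Gx Hf] /homG_P[y Gy Hg]; apply/homG_P.
exists (y * x); rewrite ?groupM // => z Pz /=.
have [Ef Qf] := Hf z Pz; have [Eg Rg] := Hg _ Qf.
by split=> //; rewrite Eg Ef invMg conjgM.
Qed.

Let homG_conj (P Q : {group gT}) f : P \subset T -> Q \subset T ->
  conj_hom T P Q f -> homG P Q f.
Proof.
move=> _ _ /exists_inP[x Tx H]; apply/exists_inP; exists x => //.
exact: (subsetP sTG).
Qed.

Let homG_inj (P Q : {group gT}) f : P \subset T -> Q \subset T ->
  homG P Q f ->
  [/\ {in P &, {morph f : x y / x * y}}, {in P &, injective f}
    & {in P, forall x, f x \in Q}].
Proof.
move=> _ _ /homG_P[x Gx H]; split=> [y z Py Pz|y z Py Pz|y /H[]//].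
  by rewrite !(proj1 (H _ _)) ?groupM // conjMg.
by rewrite !(proj1 (H _ _)) // => /conjg_inj.
Qed.

Let homG_factor (P Q : {group gT}) f : P \subset T -> Q \subset T ->
  homG P Q f -> exists2 R : {group gT}, R \subset Q & iso_in homG P R f.
Proof.
move=> _ _ /homG_P[x Gx H]; exists (P :^ x^-1)%G.
  by apply/subsetP=> _ /imsetP[g Pg ->]; have [<-] := H g Pg.
split.
  by apply/homG_P; exists x => // g Pg; rewrite (proj1 (H g Pg)) memJ_conjg.
exists (conjg^~ x); split=> [|g Pg|_ /imsetP[g Pg ->]].
- apply/homG_P; exists x^-1; rewrite ?groupV // => g; rewrite invgK.
  by rewrite /= mem_conjg invgK.
- by rewrite (proj1 (H g Pg)) conjgKV.
- by rewrite conjgKV (proj1 (H g Pg)).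
Qed.

Definition fusion_of_group : fusion_system T :=
  @FusionSystem gT T homG homG_ext homG_id homG_comp homG_conj homG_inj homG_factor.

End FusionOfGroup.

(* Equality F = E of fusion systems, with F over S and E over the isomorphic
   copy iota(S) of S: f : P -> Q belongs to F exactly when the corresponding
   map iota f iota^-1 : iota(P) -> iota(Q) belongs to E. *)
Definition fusion_eq_along (gT hT : finGroupType) (S : {group gT})
    (iota : {morphism S >-> hT}) (F : fusion_system S)
    (E : fusion_system (iota @* S)) : Prop :=
  forall (P Q : {group gT}) (f : gT -> gT) (f' : hT -> hT),
    P \subset S -> Q \subset S -> {in P, forall x, f x \in Q} ->
    {in P, forall x, f' (iota x) = iota (f x)} ->
    F P Q f = E (iota @* P)%G (iota @* Q)%G f'.

Definition p'_reduced (p : nat) (gT : finGroupType) (G : {group gT}) : Prop :=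
  forall N : {group gT}, N <| G -> coprime p #|N| -> N :=: 1.

Definition p_constrained (p : nat) (gT : finGroupType) (G : {group gT}) : Prop :=
  p'_reduced p G /\
  exists P : {group gT}, [/\ P <| G, p.-group P & 'C_G(P) \subset P].

(* G is a p'-reduced p-constrained group containing S, embedded through iota, as
   a Sylow p-subgroup, and F = F_S(G). *)
Record realizes (p : nat) (gT : finGroupType) (S : {group gT})
    (F : fusion_system S) (hT : finGroupType) (G : {group hT})
    (iota : {morphism S >-> hT}) : Prop := Realizes {
  realizes_inj : 'injm iota;
  realizes_Sylow : p.-Sylow(G) (iota @* S);
  realizes_reduced : p'_reduced p G;
  realizes_constrained : p_constrained p G;
  realizes_fusion :
    fusion_eq_along F (fusion_of_group (pHall_sub realizes_Sylow))
}.

(* Main.v *)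
(* Write [Z] for 'Z(Q), [A] for Aut_F(Q), [c_s] for the automorphism induced on
   Q by s, and P = {c_s | s in S}, a Sylow p-subgroup of A.

   Existence.  Choose representatives a_i of the cosets i in I = P \ A.  The
   pairs (alpha, g) with alpha in A, g : I -> S and a_i alpha = c_(g i) a_(i alpha)
   form a subgroup Gamma of a wreath product, which is an extension of A by the
   group Z^I coinduced from Z.  Extending automorphisms of Q by saturation, one
   orbit of S on I at a time, lifts s |-> c_s to an embedding of S in Gamma.
   The norm map Z^I -> Z, g |-> prod_i a_i (g i), is A-equivariant and sends the
   image of z in Z to z^|I|, and p does not divide |I|; hence G = Gamma / ker norm
   is an extension of A by Z that contains S as a Sylow subgroup.  (This is the
   corestriction from P to A of the class of S, at the level of groups.)
   An F-morphism b defined on N >= Q is induced by an element of Gamma because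
   two F-morphisms which agree on Q differ by conjugation by an element of Z.

   Uniqueness.  If G1 and G2 realize F, then Q is normal in both and contains its
   centralizers.  The fibre product D of G1 and G2 over A contains the diagonal
   copies of S and Z, and in D / Z the kernel (Z x Z) / Z of the map to A is
   complemented in a Sylow subgroup, by S / Z.  By Gaschutz' theorem it has a
   complement in D / Z, whose inverse image in D is the graph of an isomorphism
   from G1 to G2. *)

From HB Require Import structures.
Require Import Defs.
From mathcomp Require Import all_boot ssralg all_fingroup all_solvable.

Set Implicit Arguments.
Unset Strict Implicit.
Unset Printing Implicit Defensive.

Local Open Scope group_scope.

(** * Morphisms of a fusion system *)

Section HomTheory.

Variables (gT : finGroupType) (S : {group gT}) (F : fusion_system S).
Implicit Types (P Q R : {group gT}) (f g : gT -> gT).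

Lemma hom_incl P R : P \subset R -> R \subset S -> F P R id.
Proof.
move=> sPR sRS; apply: hom_conj (subset_trans sPR sRS) sRS _.
apply/exists_inP; exists 1; rewrite ?group1 //.
by apply/forall_inP=> x Px; rewrite invg1 conjg1 eqxx (subsetP sPR).
Qed.

Lemma hom_restrict P P' R f :
  P' \subset P -> P \subset S -> R \subset S -> F P R f -> F P' R f.
Proof.
move=> sP'P sPS sRS; apply: (hom_comp (f := id) (subset_trans sP'P sPS) sPS sRS).
exact: hom_incl.
Qed.

Lemma hom_widen P R R' f :
  R \subset R' -> P \subset S -> R' \subset S -> F P R f -> F P R' f.
Proof.
move=> sRR' sPS sR'S Ff; have sRS := subset_trans sRR' sR'S.
exact: (hom_comp (g := id) sPS sRS sR'S Ff (hom_incl _ _)).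
Qed.

Lemma iso_in_im P R f : P \subset S -> R \subset S -> iso_in F P R f -> R = f @: P :> {set gT}.
Proof.
move=> sPS sRS [Ff [g [Fg fK gK]]].
have [_ _ PRf] := hom_inj sPS sRS Ff; have [_ _ RPg] := hom_inj sRS sPS Fg.
apply/eqP; rewrite eqEsubset; apply/andP; split; apply/subsetP=> x.
  by move=> Rx; rewrite -(gK x Rx) imset_f ?RPg.
by case/imsetP=> y Py ->; apply: PRf.
Qed.

(** The image of f, through which f factors in F, also lies in R', so the inclusion into R can be
    exchanged for one into R'. *)
Lemma hom_narrow P R R' f : P \subset S -> R \subset S -> R' \subset S ->
  F P R f -> {in P, forall x, f x \in R'} -> F P R' f.
Proof.
move=> sPS sRS sR'S Ff PR'f; have [R0 sR0R isof] := hom_factor sPS sRS Ff.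
have sR0S := subset_trans sR0R sRS.
apply: (@hom_widen _ R0) => //; last by case: isof.
by rewrite (iso_in_im _ _ isof) //; apply/subsetP=> _ /imsetP[x Px ->]; apply: PR'f.
Qed.

Lemma hom_inv P R f : P \subset S -> R \subset S -> F P R f -> R = f @: P :> {set gT} ->
  exists g, [/\ F R P g, {in P, cancel f g} & {in R, cancel g f}].
Proof.
move=> sPS sRS Ff defR; have [R0 sR0R isof] := hom_factor sPS sRS Ff.
have eqR0 : R0 = R.
  by apply: val_inj; rewrite /= defR (iso_in_im _ _ isof) // (subset_trans sR0R).
by rewrite eqR0 in isof; case: isof.
Qed.

Lemma hom_conjg P R s : P \subset S -> R \subset S -> s \in S ->
  {in P, forall x, x ^ s \in R} -> F P R (conjg^~ s).
Proof.
move=> sPS sRS Ss PRs; apply: hom_conj => //; apply/exists_inP.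
exists s^-1; rewrite ?groupV //; apply/forall_inP=> x Px.
by rewrite invgK eqxx PRs.
Qed.

Lemma hom_morphJ P R f : P \subset S -> R \subset S -> F P R f ->
  {in P &, {morph f : x y / x ^ y}}.
Proof.
move=> sPS sRS Ff; have [fM _ _] := hom_inj sPS sRS Ff.
have f1 : f 1 = 1 by apply: (mulgI (f 1)); rewrite -fM ?group1 // !mulg1.
have fV : {in P, {morph f : x / x^-1}}.
  by move=> y Py; apply: (mulgI (f y)); rewrite -fM ?groupV // !mulgV f1.
by move=> y z Py Pz; rewrite !conjgE !fM ?groupM ?groupV ?fV.
Qed.

End HomTheory.

(** * The regular wreath product *)

Section RegularWreath.

Variables (aT gT : finGroupType).

(* The base group is indexed by all subsets of aT, on which aT acts by right
   translation, so that it contains the functions on the cosets of any subgroup. *)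
Definition regular_wreath : Type := aT * {ffun {set aT} -> gT}.

HB.instance Definition _ := Finite.on regular_wreath.

Implicit Types w v : regular_wreath.

(** Composing a_i alpha = c_(g i) a_(i alpha) with the same relation for (beta, h) gives a_i alpha
    beta = c_(g i) c_(h (i alpha)) a_(i alpha beta), hence the shift of the second function by
    [w.1]. *)
Definition wreath_mul w v : regular_wreath :=
  (w.1 * v.1, [ffun i => w.2 i * v.2 (i :* w.1)]).
Definition wreath_one : regular_wreath := (1, [ffun=> 1]).
Definition wreath_inv w : regular_wreath := (w.1^-1, [ffun i => (w.2 (i :* w.1^-1))^-1]).

Lemma wreath_mulA : associative wreath_mul.
Proof.
move=> w v u; congr (_, _); first exact: mulgA.
by apply/ffunP=> i; rewrite !ffunE rcosetM mulgA.
Qed.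

Lemma wreath_mul1 : left_id wreath_one wreath_mul.
Proof.
case=> x g; congr (_, _); first exact: mul1g.
by apply/ffunP=> i; rewrite !ffunE rcoset1 mul1g.
Qed.

Lemma wreath_mulV : left_inverse wreath_one wreath_inv wreath_mul.
Proof.
case=> x g; congr (_, _); first exact: mulVg.
by apply/ffunP=> i; rewrite !ffunE mulVg.
Qed.

HB.instance Definition _ :=
  Finite_isGroup.Build regular_wreath wreath_mulA wreath_mul1 wreath_mulV.

Lemma wreath_fstM w v : (w * v).1 = w.1 * v.1. Proof. by []. Qed.

Lemma wreath_sndM w v i : (w * v).2 i = w.2 i * v.2 (i :* w.1).
Proof. by rewrite ffunE. Qed.

Lemma wreath_eqP w v : w.1 = v.1 -> w.2 =1 v.2 -> w = v.
Proof. by case: w v => [x g] [y h] /= -> /ffunP->. Qed.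

End RegularWreath.

(** Meant for the two projections of a fibre product, which are defined on the whole type but whose
    injectivity is known only on T. *)
Lemma isog_of_trivial_ker (aT rT : finGroupType) (T : {group aT}) (G : {group rT})
    (f : {morphism [set: aT] >-> rT}) :
  {in T, forall x, f x = 1 -> x = 1} -> f @* T = G -> T \isog G.
Proof.
move=> kerT <-; apply/isogP; exists (restrm (subsetT T) f).
  apply/subsetP=> x; rewrite ker_restrm => /setIP[Tx /mker/(kerT x Tx)->].
  exact: group1.
by rewrite morphim_restrm setIid.
Qed.

(** * A normal centric subgroup *)

Section NormalCentric.

Variables (p : nat) (gT : finGroupType) (S : {group gT}) (F : fusion_system S).
Variable Q : {group gT}.
Hypotheses (pr_p : prime p) (pS : p.-group S) (satF : saturated F p).
Hypotheses (cQ : centric F Q) (nQ : normal_in F Q).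

Let nsQS : Q <| S. Proof. by case: nQ. Qed.
Let sQS : Q \subset S. Proof. exact: normal_sub. Qed.
Let nQS : S \subset 'N(Q). Proof. exact: normal_norm. Qed.

Lemma centric_cent : 'C_S(Q) = 'Z(Q).
Proof. by apply: cQ => //; exists id; split; [|exists id; split=> //]; apply: hom_id. Qed.

Lemma sZS : 'Z(Q) \subset S.
Proof. exact: subset_trans (center_sub Q) sQS. Qed.

Lemma hom_im (P R : {group gT}) f : P \subset S -> R \subset S -> Q \subset P ->
  F P R f -> f @: Q = Q.
Proof.
move=> sPS sRS sQP Ff; have [_ nQF] := nQ.
have [b [_ fb bQ]] := nQF _ _ _ sPS sRS Ff.
rewrite -[RHS]bQ; apply: eq_in_imset => x Qx; by rewrite fb // (subsetP sQP).
Qed.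

Lemma hom_Q (P R : {group gT}) f : P \subset S -> R \subset S -> Q \subset P ->
  F P R f -> {in Q, forall x, f x \in Q}.
Proof. by move=> sPS sRS sQP Ff x Qx; rewrite -(hom_im sPS sRS sQP Ff) imset_f. Qed.

(** Being alone in its class makes Q fully normalized and fully centralized for free, so that both
    saturation axioms apply to it. *)
Lemma fconj_Q (P : {group gT}) : P \subset S -> fconj F Q P -> P = Q.
Proof.
move=> sPS [f isof]; apply: val_inj; rewrite /= (iso_in_im _ _ isof) //.
by apply: (@hom_im Q P) => //; case: isof.
Qed.

Lemma fully_normalized_Q : fully_normalized F Q.
Proof. by move=> P sPS /(fconj_Q sPS)->. Qed.

Lemma fully_centralized_Q : fully_centralized F Q.
Proof. by move=> P sPS /(fconj_Q sPS)->. Qed.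

Lemma Sylow_AutS : p.-Sylow(AutF F Q) (AutG S Q).
Proof. by have [sat _] := satF; case: (sat Q sQS fully_normalized_Q). Qed.

Lemma conj_autEQ s x : s \in S -> x \in Q -> conj_aut Q s x = x ^ s.
Proof. by move=> Ss Qx; rewrite norm_conj_autE ?(subsetP nQS). Qed.

Lemma AutG_conj_aut : AutG S Q = conj_aut Q @* S.
Proof.
apply/setP=> a; apply/setIdP/morphimP=> [[Aa /exists_inP[s Ss /forall_inP Ha]] | [s Ns Ss ->]].
  exists s^-1; rewrite ?groupV ?(subsetP nQS) //; apply: (eq_Aut Aa).
    by apply: Aut_aut.
  by move=> x Qx; rewrite conj_autEQ ?groupV //; have /andP[/eqP] := Ha x Qx.
split; first exact: Aut_aut.
apply/exists_inP; exists s^-1; rewrite ?groupV //; apply/forall_inP=> x Qx.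
by rewrite conj_autEQ // invgK eqxx memJ_norm.
Qed.

Lemma conj_autM : {in S &, {morph conj_aut Q : x y / x * y}}.
Proof. by move=> x y Sx Sy; rewrite morphM ?(subsetP nQS). Qed.

Lemma conj_aut_AutF s : s \in S -> conj_aut Q s \in AutF F Q.
Proof.
move=> Ss; apply: (subsetP (pHall_sub Sylow_AutS)).
by rewrite AutG_conj_aut mem_morphim ?(subsetP nQS).
Qed.

Lemma conj_aut1P s : s \in S -> reflect (conj_aut Q s = 1) (s \in 'Z(Q)).
Proof.
move=> Ss; rewrite -centric_cent inE Ss -ker_conj_aut /=.
by apply: kerP; rewrite (subsetP nQS).
Qed.

(** The condition on N says that a conjugates each c_x into Aut_S(Q), so N lies in N_a, and the
    second saturation axiom extends a because Q is fully centralized. *)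
Lemma AutF_ext (a : {perm gT}) (N : {group gT}) : a \in AutF F Q ->
  Q \subset N -> N \subset S ->
  (forall x, x \in N -> exists2 y, y \in S & {in Q, forall q, a (q ^ x) = a q ^ y}) ->
  exists2 psi, F N S psi & {in Q, psi =1 a}.
Proof.
case/setIdP=> Aa Fa sQN sNS Na; have [_ sat] := satF.
pose phi := autm_morphism Aa.
have imphi : (phi @* Q)%G = Q by apply: val_inj; rewrite /= im_autm.
have Fphi : F Q S phi by apply: (@hom_widen _ _ _ Q Q).
have fcphi : fully_centralized F (phi @* Q)%G by rewrite imphi; apply: fully_centralized_Q.
have [psi Fpsi psiE] := sat Q phi sQS Fphi fcphi.
exists psi => //; apply: hom_restrict Fpsi => //; last first.
  by apply: subset_trans (subsetIl S 'N(Q)); apply/subsetP => x /setIdP[].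
apply/subsetP=> x Nx; apply/setIdP; split.
  by rewrite inE (subsetP sNS) // (subsetP nQS) // (subsetP sNS).
(* [Nphi] is defined through conjugation by the inverse of its elements. *)
have [y Sy ay] := Na _ (groupVr Nx).
apply/exists_inP; exists (conj_aut Q y).
  have -> : phi @* Q = Q by exact: im_autm.
  by rewrite AutG_conj_aut mem_morphim // (subsetP nQS).
apply/forall_inP=> q Qq /=; rewrite !autmE ay // conj_autEQ //.
by rewrite Aut_closed.
Qed.

(** * Rigidity: F-morphisms that agree on Q *)

Lemma fully_normalized_conj (P : {group gT}) : P \subset S ->
  exists2 M : {group gT}, M \subset S /\ fully_normalized F M & fconj F P M.
Proof.
(* To maximize over the conjugates of P, conjugacy must be a boolean predicate: morphisms become
   finite functions, and an inverse is recovered from R = f(P) by [hom_inv]. *)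
move=> sPS; pose isob (R : {group gT}) :=
  (R \subset S) && [exists f : {ffun gT -> gT}, F P R f && (R == f @: P :> {set gT})].
have isobP (R : {group gT}) : R \subset S -> reflect (fconj F P R) (isob R).
  move=> sRS; rewrite /isob sRS /=; apply: (iffP existsP) => [[f /andP[Ff /eqP defR]]|[f isof]].
    exists f; split=> //; exact: hom_inv Ff defR.
  exists [ffun x => f x]; apply/andP; split.
    rewrite (@hom_ext _ _ F P R _ f) // => [|x _]; last by rewrite ffunE.
    by case: isof.
  rewrite (iso_in_im _ _ isof) //; apply/eqP.
  by apply: eq_in_imset => x _; rewrite ffunE.
have isobPP : isob P.
  apply/isobP=> //; exists id; split; first exact: hom_id.
  by exists id; split=> //; apply: hom_id.
case: (@arg_maxnP _ P isob (fun R => #|'N_S(R)|) isobPP) => M isoM maxM.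
have sMS : M \subset S by case/andP: isoM.
have [f [Ff [f' [Ff' fK f'K]]]] := isobP M sMS isoM.
exists M; last by exists f; split=> //; exists f'.
split=> // R sRS [g [Fg [g' [Fg' gK g'K]]]]; apply: maxM; apply/isobP => //.
have [_ _ PMf] := hom_inj sPS sMS Ff; have [_ _ RMg'] := hom_inj sRS sMS Fg'.
exists (g \o f); split; first exact: hom_comp Ff Fg.
exists (f' \o g'); split; first exact: hom_comp Fg' Ff'.
  by move=> x Px; rewrite /= gK ?fK ?PMf.
by move=> x Rx; rewrite /= f'K ?g'K ?RMg'.
Qed.

Lemma hom_AutF (P : {group gT}) f : P \subset S -> F P P f ->
  exists2 a, a \in AutF F P & {in P, a =1 f}.
Proof.
move=> sPS Ff; have [fM injf Pf] := hom_inj sPS sPS Ff.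
pose fm := Morphism fM.
have injfm : 'injm fm by apply/injmP.
have imfm : fm @* P = P.
  apply/eqP; rewrite eqEcard card_injm // leqnn andbT.
  by apply/subsetP=> _ /morphimP[x _ Px ->]; apply: Pf.
have afm : {in P, aut injfm imfm =1 f} by move=> x Px; rewrite autE.
exists (aut injfm imfm) => //; apply/setIdP; split; first exact: Aut_aut.
by rewrite (@hom_ext _ _ F P P _ f).
Qed.

(** Since c fixes both q and q ^ x, the elements x and c x conjugate q in the same way; their
    quotient therefore lies in C_S(Q) = Z(Q). *)
Lemma hom_fixQ_center (M : {group gT}) c x : M \subset S -> Q \subset M -> F M S c ->
  {in Q, c =1 id} -> x \in M -> c x * x^-1 \in 'Z(Q).
Proof.
move=> sMS sQM Fc cQid Mx; have cJ := hom_morphJ sMS (subxx S) Fc.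
have [_ _ Sc] := hom_inj sMS (subxx S) Fc.
have Sx := subsetP sMS x Mx.
rewrite -centric_cent inE groupM ?groupV ?Sc //=; apply/centP=> q Qq.
have nQx : x \in 'N(Q) by rewrite (subsetP nQS).
have := cJ q x (subsetP sQM q Qq) Mx; rewrite (cQid q Qq) cQid ?memJ_norm // => qcx.
by apply/commute_sym/commgP/conjg_fixP; rewrite conjgM -qcx conjgK.
Qed.

(* The F-automorphisms of M that fix Q pointwise form a normal p-subgroup, which
   is therefore contained in the Sylow subgroup Aut_S(M). *)
Lemma fully_normalized_fixQ (M : {group gT}) c : M \subset S -> fully_normalized F M ->
  Q \subset M -> F M M c -> {in Q, c =1 id} ->
  exists2 z, z \in 'Z(Q) & {in M, forall x, c x = x ^ z}.
Proof.
move=> sMS fnM sQM Fc cQid; have [sat _] := satF.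
have [_ sylM] := sat M sMS fnM.
have [a AFa ac] := hom_AutF sMS Fc.
pose A := group (AutF_group_set F sMS); pose C := ('C_A(Q | 'P))%G.
have Fsub b : b \in A -> F M M b by case/setIdP.
have fixC b : b \in C -> {in Q, b =1 id}.
  by case/setIP=> _ /astabP Cb x Qx; apply: Cb.
have nCA : C <| A.
  apply: normalGI (astab_normal 'P Q); apply/subsetP=> b Ab.
  rewrite !inE; apply/subsetP=> x Qx; rewrite inE /= apermE.
  exact: (hom_Q sMS sMS sQM (Fsub b Ab)).
have pC : p.-group C.
  apply/pgroupP=> r pr_r /(Cauchy pr_r)[b Cb ob].
  have Ab : b \in A by case/setIP: Cb.
  have FbS : F M S b by apply: hom_widen (Fsub b Ab).
  have [bM _ _] := hom_inj sMS sMS (Fsub b Ab).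
  (* For each x, b x = z x with z in Z(Q) fixed by b, so that b^k x = z^k x; thus the order of b
     divides |Z(Q)|, a power of p. *)
  suff b1 : b ^+ #|'Z(Q)| = 1.
    rewrite -ob; apply: (pgroupP (pgroupS sZS pS)); first by rewrite ob.
    by rewrite order_dvdn b1.
  apply/permP=> x; rewrite perm1; have [Mx|notMx] := boolP (x \in M); last first.
    case/setIdP: Ab => Aut_b _; apply: (out_Aut _ notMx).
    exact: groupX (Aut_b : b \in Aut_group M).
  have Zb := hom_fixQ_center sMS sQM FbS (fixC b Cb) Mx.
  have Qb := subsetP (center_sub Q) _ Zb.
  suff -> : (b ^+ #|'Z(Q)|) x = (b x * x^-1) ^+ #|'Z(Q)| * x by rewrite expg_cardG ?mul1g.
  elim: #|_| => [|k IHk]; first by rewrite perm1 mul1g.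
  have Qbk := groupX k Qb.
  rewrite expgSr permM IHk (bM _ _ (subsetP sQM _ Qbk) Mx) (fixC b Cb _ Qbk) /=.
  by rewrite expgSr -!mulgA mulVg mulg1.
have sylA : p.-Sylow(A) (AutG_group S M) by [].
have Ca : a \in AutG S M.
  apply: (subsetP (pcore_sub_Hall sylA)); apply: (subsetP (pcore_max pC nCA)).
  rewrite inE AFa; apply/astabP=> x Qx /=.
  by rewrite apermE ac ?cQid ?(subsetP sQM).
case/setIdP: Ca => _ /exists_inP[s Ss /forall_inP Ha].
have aE x : x \in M -> c x = x ^ s^-1 by move=> Mx; have /andP[/eqP<-] := Ha x Mx; rewrite ac.
exists s^-1 => //; rewrite -centric_cent inE groupV Ss /=.
apply/centP=> q Qq; apply/commute_sym/commgP/conjg_fixP.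
by rewrite -aE ?cQid ?(subsetP sQM).
Qed.

Lemma hom_center (P R : {group gT}) f z : P \subset S -> R \subset S -> Q \subset P ->
  F P R f -> z \in 'Z(Q) -> f z \in 'Z(Q).
Proof.
move=> sPS sRS sQP Ff Zz; have [_ _ PRf] := hom_inj sPS sRS Ff.
have Qz := subsetP (center_sub Q) z Zz; have Pz := subsetP sQP z Qz.
rewrite inE (hom_Q sPS sRS sQP Ff) //=; apply/centP=> q.
rewrite -{1}(hom_im sPS sRS sQP Ff) => /imsetP[r Qr ->].
have [fM _ _] := hom_inj sPS sRS Ff; have Pr := subsetP sQP r Qr.
by rewrite /commute -!fM //; congr (f _); case/setIP: Zz => _ /centP/(_ r Qr).
Qed.

(** The inverse of f followed by g is an F-automorphism of f(N) trivial on Q. It is transported to a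
    fully normalized conjugate M of f(N), where it is conjugation by an element of Z(Q), and this
    element is pulled back. *)
Lemma hom_unique (N : {group gT}) f g : N \subset S -> Q \subset N ->
  F N S f -> F N S g -> {in Q, f =1 g} ->
  exists2 z, z \in 'Z(Q) & {in N, forall x, g x = f x ^ z}.
Proof.
move=> sNS sQN Ff Fg eqfg; have [R0 sR0S isof] := hom_factor sNS (subxx S) Ff.
have [Ff0 [f' [Ff' fK f'K]]] := isof.
have [_ _ NRf] := hom_inj sNS sR0S Ff0.
have sQR : Q \subset R0.
  rewrite (iso_in_im sNS sR0S isof) -{1}(hom_im sNS (subxx S) sQN Ff).
  exact: imsetS.
pose c := g \o f'.
have FcS : F R0 S c by apply: hom_comp Ff' Fg.
have cQid : {in Q, c =1 id}.
  move=> q; rewrite -{1}(hom_im sNS (subxx S) sQN Ff) => /imsetP[r Qr ->].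
  by rewrite /c /= fK ?eqfg // (subsetP sQN).
(* c x lies in Z(Q) x, so c preserves f(N). *)
have Fc : F R0 R0 c.
  apply: (hom_narrow sR0S (subxx S) sR0S FcS) => x Rx.
  have Zx := hom_fixQ_center sR0S sQR FcS cQid Rx.
  by rewrite -[c x](mulgKV x) groupM // (subsetP sQR) // (subsetP (center_sub Q)).
have [M [sMS fnM] [w [Fw [w' [Fw' wK w'K]]]]] := fully_normalized_conj sR0S.
have [_ _ Mw] := hom_inj sR0S sMS Fw; have [_ _ Rw'] := hom_inj sMS sR0S Fw'.
have [_ _ Rc] := hom_inj sR0S sR0S Fc.
have sQM : Q \subset M.
  have isow : iso_in F R0 M w by split=> //; exists w'.
  by rewrite (iso_in_im sR0S sMS isow) -{1}(hom_im sR0S sMS sQR Fw) imsetS.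
have Fd : F M M (w \o c \o w').
  by apply: (hom_comp (Q := R0) (f := w')) => //; apply: hom_comp Fc Fw.
have dQid : {in Q, w \o c \o w' =1 id}.
  move=> q Qq /=; have Qw'q : w' q \in Q by apply: (hom_Q sMS sR0S sQM Fw').
  by rewrite -/(c _) cQid //= w'K // (subsetP sQM).
have [z Zz dz] := fully_normalized_fixQ sMS fnM sQM Fd dQid.
have Mz : z \in M by rewrite (subsetP sQM) // (subsetP (center_sub Q)).
exists (w' z); first exact: (hom_center sMS sR0S sQM Fw' Zz).
move=> x Nx; have Rfx : f x \in R0 by apply: NRf.
have := dz (w (f x)) (Mw _ Rfx); rewrite /= wK // => /(congr1 w').
have w'J := hom_morphJ sMS sR0S Fw'.
by rewrite (wK _ (Rc _ Rfx)) w'J ?Mw // wK // /c /= fK.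
Qed.

(** * Action of Aut_F(Q), and of S through it, on the cosets of Aut_S(Q) *)

Local Notation A := (group (AutF_group_set F sQS)).
Local Notation P := (AutG_group S Q).
Local Notation c := (conj_aut Q).
Local Notation I := (rcosets (AutG S Q) (AutF F Q)).

(** This is f (q ^ x) = f q ^ f x on Q, read in Aut_F(Q) with permutations composed from left to
    right. *)
Lemma AutF_conj_hom (N : {group gT}) f a x : N \subset S -> Q \subset N ->
  F N S f -> a \in AutF F Q -> {in Q, f =1 a} -> x \in N -> c x * a = a * c (f x).
Proof.
move=> sNS sQN Ff Aa fa Nx; have Aut_in b : b \in AutF F Q -> b \in Aut Q by case/setIdP.
have [_ _ Sf] := hom_inj sNS (subxx S) Ff; have Sx := subsetP sNS x Nx.
have fJ := hom_morphJ sNS (subxx S) Ff.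
apply: (eq_Aut (A := Q)) => [||q Qq].
- by apply: groupM; apply: Aut_in; rewrite ?conj_aut_AutF.
- by apply: groupM; apply: Aut_in; rewrite ?conj_aut_AutF ?Sf.
have Qqx : q ^ x \in Q by rewrite memJ_norm ?(subsetP nQS).
have Qaq : a q \in Q by rewrite Aut_closed ?(Aut_in a).
rewrite !permM !conj_autEQ ?Sf // -!fa //.
by rewrite fJ // (subsetP sQN).
Qed.

Lemma AutF_hom a : a \in AutF F Q -> F Q S a.
Proof. by case/setIdP=> _; apply: hom_widen. Qed.

Lemma AutF_conjQ a q : a \in AutF F Q -> q \in Q -> a * c q = c (a^-1 q) * a.
Proof.
move=> Aa Qq; have Aa1 : a^-1 \in AutF F Q by apply: (groupVr (G := A)).
have := AutF_conj_hom sQS (subxx Q) (AutF_hom Aa1) Aa1 (fun _ _ => erefl) Qq.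
by move=> eqa; rewrite -[LHS](mulgKV a) -(mulgA a) eqa mulKVg.
Qed.

Lemma rcosets_mul i a : i \in I -> a \in AutF F Q -> i :* a \in I.
Proof.
case/rcosetsP=> b Ab -> Aa; apply/rcosetsP; exists (b * a); last by rewrite rcosetM.
exact: (groupM (Ab : b \in A) Aa).
Qed.

Lemma rcosets_memE i a : i \in I -> a \in i -> i = AutG S Q :* a /\ a \in AutF F Q.
Proof.
case/rcosetsP=> b Ab -> ab; split; first exact/esym/(@rcoset_eqP _ P).
case/rcosetP: ab => h Ph ->; apply: (groupM (G := A)) => //.
exact: (subsetP (pHall_sub Sylow_AutS)).
Qed.

Section Orbits.

Variable N : {group gT}.
Hypothesis sNS : N \subset S.

(** Picking from the orbit as a set makes the result depend on the orbit alone, which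
    [orbit_rep_mul] exploits. *)
Definition orbit_rep (i : {set {perm gT}}) :=
  odflt i [pick j in [set i :* c s | s in N]].

Definition orbit_trans i := odflt 1 [pick s in N | orbit_rep i :* c s == i].

Lemma orbit_repP i : exists2 s, s \in N & orbit_rep i = i :* c s.
Proof.
rewrite /orbit_rep; case: pickP => [j /imsetP[s Ns ->] | /(_ i)]; first by exists s.
case/imsetP; exists 1 => //.
by rewrite morph1 rcoset1.
Qed.

Lemma orbit_transP i : orbit_trans i \in N /\ orbit_rep i :* c (orbit_trans i) = i.
Proof.
rewrite /orbit_trans; case: pickP => [s /andP[Ns /eqP]//|]; have [s Ns ->] := orbit_repP i.
move/(_ s^-1)/andP; case; split; first by rewrite groupV.
by rewrite -rcosetM -conj_autM ?groupV ?(subsetP sNS) // mulgV morph1 rcoset1.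
Qed.

Lemma orbit_rep_mul i s : s \in N -> orbit_rep (i :* c s) = orbit_rep i.
Proof.
move=> Ns; have Ss := subsetP sNS s Ns; rewrite /orbit_rep.
have -> : [set i :* c s :* c t | t in N] = [set i :* c t | t in N].
  apply/setP=> j; apply/imsetP/imsetP=> -[t Nt ->].
    by exists (s * t); rewrite ?groupM // conj_autM ?(subsetP sNS) // rcosetM.
  exists (s^-1 * t); first by rewrite groupM ?groupV.
  by rewrite -rcosetM -conj_autM ?groupM ?groupV ?(subsetP sNS) // mulKVg.
case: pickP => // /(_ i) /imsetP[]; exists 1 => //.
by rewrite morph1 rcoset1.
Qed.

Lemma orbit_rep_in i : i \in I -> orbit_rep i \in I.
Proof.
move=> Ii; have [s Ns ->] := orbit_repP i.
by rewrite rcosets_mul // conj_aut_AutF // (subsetP sNS).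
Qed.

Definition stab i := [set s in N | i :* c s == i].

Lemma stab_group_set i : group_set (stab i).
Proof.
apply/group_setP; split=> [|s t]; first by rewrite inE group1 morph1 rcoset1 eqxx.
case/setIdP=> Ns /eqP si /setIdP[Nt /eqP ti]; rewrite inE groupM //=.
by rewrite conj_autM ?(subsetP sNS) // rcosetM si ti.
Qed.

Canonical stab_group i := group (stab_group_set i).

(** As for Schreier generators, going from the representative to i, then by s, then back, returns to
    the representative. In this way data on one stabilizer spread over the whole orbit. *)
Lemma orbit_trans_stab i s : s \in N ->
  orbit_trans i * s * (orbit_trans (i :* c s))^-1 \in stab (orbit_rep i).
Proof.
move=> Ns; have [Nt tE] := orbit_transP i; have [Nu uE] := orbit_transP (i :* c s).
rewrite inE !groupM ?groupV //=; apply/eqP.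
rewrite !conj_autM ?groupM ?groupV ?(subsetP sNS) // !rcosetM tE -{1}uE.
rewrite orbit_rep_mul // -rcosetM -conj_autM ?groupV ?(subsetP sNS) //.
by rewrite mulgV morph1 rcoset1.
Qed.

(** For the coset of a, moving c_q across a turns it into conjugation by the element a^-1 q of Q,
    which Aut_S(Q) absorbs. Stabilizers are thus overgroups of Q, to which the extension and
    rigidity lemmas apply. *)
Lemma sub_stab i : i \in I -> Q \subset N -> Q \subset stab i.
Proof.
move=> Ii sQN; apply/subsetP=> q Qq; rewrite inE (subsetP sQN) //=.
case/rcosetsP: Ii => a Aa ->; have Sq := subsetP sQS q Qq.
have Sq' : a^-1 q \in S.
  by apply: (subsetP sQS); rewrite Aut_closed ?groupV //; case/setIdP: Aa.
apply/eqP; rewrite -rcosetM AutF_conjQ // rcosetM; congr (_ :* _).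
by apply/rcoset_id; rewrite /= AutG_conj_aut mem_morphim ?(subsetP nQS).
Qed.

End Orbits.

(* a is a transversal of the cosets of Aut_S(Q), and s |-> (c_s, f s) embeds S in
   the wreath product of S by A. *)
Record transversal_cocycle (a : {set {perm gT}} -> {perm gT})
    (f : gT -> {set {perm gT}} -> gT) : Prop := TransversalCocycle {
  tc_mem : {in I, forall i, a i \in i};
  tc_S : {in S & I, forall s i, f s i \in S};
  tc_conj : {in S & I, forall s i, a i * c s = c (f s i) * a (i :* c s)};
  tc_mul : {in S & S, forall s t i, i \in I -> f (s * t) i = f s i * f t (i :* c s)};
  tc_Q : {in Q & I, forall q i, f q i = (a i)^-1 q};
  tc_hom : forall (N : {group gT}) i, i \in I -> N \subset stab S i -> F N S (f^~ i)
}.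

Lemma mem_repr_rcosets i : i \in I -> repr i \in i.
Proof. by case/rcosetsP=> b _ ->; apply: mem_repr (rcoset_refl P b). Qed.

(** On the stabilizer of a coset with representative r, saturation extends r^-1 to an F-morphism psi
    into S. The transversal and the cocycle are then spread along the S-orbits as in an induced
    representation. *)
Lemma transversal_cocycle_exists : exists a f, transversal_cocycle a f.
Proof.
have /fin_all_exists[psi psiP] (i : {set {perm gT}}) : exists psi : gT -> gT, i \in I ->
    F (stab_group (subxx S) i) S psi /\ {in Q, psi =1 (repr i)^-1}.
  have [Ii | _] := boolP (i \in I); last by exists id.
  have [defi Ar] := rcosets_memE Ii (mem_repr_rcosets Ii).
  have Ar1 : (repr i)^-1 \in AutF F Q by apply: (groupVr (G := A)).
  have sNS : stab_group (subxx S) i \subset S by apply/subsetP=> x /setIdP[].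
  have sQN : Q \subset stab_group (subxx S) i by apply: sub_stab.
  have [x Nx|psi Fpsi psiE] := AutF_ext Ar1 sQN sNS; last by exists psi.
  have [Sx /eqP xi] := setIdP Nx.
  (* x fixes the coset of r, so r c_x r^-1 is some c_y with y in S, as [AutF_ext] requires for
     r^-1. *)
  have : repr i * c x \in i by rewrite -{2}xi mem_rcoset mulgK {2}defi (rcoset_refl P).
  rewrite {2}defi mem_rcoset AutG_conj_aut => /morphimP[y _ Sy yE].
  exists y => // q Qq; have Qq' : (repr i)^-1 q \in Q.
    by apply: (hom_Q sQS (subxx S) (subxx Q) (AutF_hom Ar1)).
  have nq : q ^ x \in Q by rewrite memJ_norm ?(subsetP nQS).
  rewrite -[RHS]conj_autEQ // -yE !permM permKV.
  by rewrite conj_autEQ.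
pose sSS := subxx S.
have SE (N : {group gT}) i x : N \subset stab S i -> x \in N -> x \in S /\ i :* c x = i.
  by move=> sNs Nx; have [Sx /eqP] := setIdP (subsetP sNs x Nx).
pose o := orbit_rep S; pose t := orbit_trans S.
pose a i := repr (o i) * c (t i).
(* The argument of psi is the stabilizer element of [orbit_trans_stab]. *)
pose f s i := psi (o i) (t i * s * (t (i :* c s))^-1).
have tS i : t i \in S by case: (orbit_transP sSS i).
have tE i : o i :* c (t i) = i by case: (orbit_transP sSS i).
have oI i : i \in I -> o i \in I by move=> Ii; apply: orbit_rep_in.
have oM i s : s \in S -> o (i :* c s) = o i by move=> Ss; apply: orbit_rep_mul.
have st i s : s \in S -> t i * s * (t (i :* c s))^-1 \in stab S (o i).
  exact: orbit_trans_stab.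
have sstS i : stab_group sSS i \subset S by apply/subsetP=> x /setIdP[].
have psiS i x : i \in I -> x \in stab S i -> psi i x \in S.
  move=> Ii sx; have [Fpsi _] := psiP i Ii.
  by have [_ _ ->] := hom_inj (sstS i) sSS Fpsi.
exists a, f; split.
- move=> i Ii; rewrite -{2}(tE i) mem_rcoset mulgK; apply: mem_repr_rcosets; exact: oI.
- by move=> s i Ss Ii; apply: psiS; [apply: oI | apply: st].
- move=> s i Ss Ii; rewrite /a /f oM //.
  set u := t (i :* c s); set n := _ * _^-1.
  have nst : n \in stab S (o i) by apply: st.
  have Sn : n \in S by case/setIdP: nst.
  have [Fpsi psiE] := psiP _ (oI i Ii).
  have [_ Ar] := rcosets_memE (oI i Ii) (mem_repr_rcosets (oI i Ii)).
  have Ar1 : (repr (o i))^-1 \in AutF F Q by apply: (groupVr (G := A)).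
  have sQo : Q \subset stab_group sSS (o i) by apply: sub_stab => //; apply: oI.
  have E := AutF_conj_hom (sstS _) sQo Fpsi Ar1 psiE nst.
  have E' : repr (o i) * c n = c (psi (o i) n) * repr (o i).
    by apply: (mulgI (repr (o i))^-1); rewrite mulKg mulgA -E mulgKV.
  have tsE : t i * s = n * u by rewrite mulgKV.
  by rewrite mulgA -E' -!mulgA -!conj_autM ?tS // tsE.
- move=> s s' Ss Ss' i Ii; rewrite /f oM // conj_autM // rcosetM.
  have [Fpsi _] := psiP _ (oI i Ii); have [psiM _ _] := hom_inj (sstS _) sSS Fpsi.
  have st' := st _ _ Ss'; have := st' (i :* c s); rewrite oM // => st2.
  rewrite -psiM //; last exact: st.
  by congr (psi _ _); rewrite !mulgA mulgKV.
- move=> q i Qq Ii; have Sq := subsetP sQS q Qq.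
  have [_ qi] : q \in S /\ i :* c q = i.
    by apply: (SE Q); first apply: sub_stab.
  rewrite /f qi; have [_ psiE] := psiP _ (oI i Ii).
  have Qqt : q ^ (t i)^-1 \in Q by rewrite memJ_norm // groupV (subsetP nQS).
  rewrite -[t i * q * _]/(_ * _ * _) -{1}[t i]invgK -mulgA -conjgE psiE //.
  rewrite /a invMg permM -(morphV (conj_aut_morphism Q)) ?(subsetP nQS) //=.
  by rewrite conj_autEQ ?groupV.
- move=> N i Ii sNs.
  have sNS : N \subset S by apply/subsetP=> x /(SE _ _ _ sNs)[].
  have [Fpsi _] := psiP _ (oI i Ii).
  have sto x : x \in N -> x ^ (t i)^-1 \in stab S (o i).
    move=> Nx; have [Sx xi] := SE _ _ _ sNs Nx.
    by have := st i x Sx; rewrite xi conjgE invgK mulgA.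
  (* For x fixing i the argument of psi is a conjugate of x by an element of S independent of x, so
     f at i is a composite of F-morphisms on N. *)
  have Ft : F N (stab_group sSS (o i)) (conjg^~ (t i)^-1).
    by apply: hom_conjg; rewrite ?groupV.
  rewrite (@hom_ext _ _ F N S _ (psi (o i) \o conjg^~ (t i)^-1)) //.
    exact: hom_comp Ft Fpsi.
  move=> x Nx; have [Sx xi] := SE _ _ _ sNs Nx.
  by rewrite /f /= xi conjgE invgK mulgA.
Qed.

(* The witness g is chosen at one representative of each N-orbit, by hom_unique,
   and its values on the rest of the orbit are then forced. *)
Lemma transversal_cocycle_twist a f (N : {group gT}) b al : transversal_cocycle a f ->
    N \subset S -> Q \subset N -> F N S b -> al \in AutF F Q -> {in Q, b =1 al} ->
  exists g : {set {perm gT}} -> gT,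
    [/\ {in I, forall i, g i \in S},
        {in I, forall i, a i * al = c (g i) * a (i :* al)}
      & {in N & I, forall x i, f x i * g (i :* c x) = g i * f (b x) (i :* al)}].
Proof.
move=> tc sNS sQN Fb Aal bal; have sSS := subxx S.
have [_ _ Sb] := hom_inj sNS sSS Fb; have [bM _ _] := hom_inj sNS sSS Fb.
have Ial i : i \in I -> i :* al \in I by move=> Ii; apply: rcosets_mul.
have alc i x : x \in N -> i :* al :* c (b x) = i :* c x :* al.
  by move=> Nx; rewrite -!rcosetM (AutF_conj_hom sNS sQN Fb).
have /fin_all_exists[h hP] (i : {set {perm gT}}) : exists g : gT, i \in I ->
    [/\ g \in S, a i * al = c g * a (i :* al) &
       {in stab N i, forall x, f x i ^ g = f (b x) (i :* al)}].
  have [Ii | _] := boolP (i \in I); last by exists 1.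
  have : a i * al \in i :* al by rewrite mem_rcoset mulgK (tc_mem tc).
  have [{2}-> _] := rcosets_memE (Ial i Ii) (tc_mem tc (Ial i Ii)).
  rewrite AutG_conj_aut; case/rcosetP=> _ /morphimP[g _ Sg ->] gE.
  pose M := stab_group sNS i.
  have sMN : M \subset N by apply/subsetP=> x /setIdP[].
  have sMS := subset_trans sMN sNS.
  have sQM : Q \subset M by apply: sub_stab.
  have sMi : M \subset stab S i by apply/subsetP=> x; rewrite !inE => /andP[/(subsetP sNS)->].
  (* The two sides to be compared on the stabilizer of i are F-morphisms that agree on Q, so they
     differ by conjugation by some z in Z(Q). *)
  have F1 : F M S (conjg^~ g \o f^~ i).
    apply: hom_comp (tc_hom tc Ii sMi) _ => //.
    by apply: hom_conjg => // x Sx; apply: groupJ.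
  have Fb' : F M S b by apply: hom_restrict Fb.
  have [R sRS isoR] := hom_factor sMS sSS Fb'.
  have FR : F R S (f^~ (i :* al)).
    apply: (tc_hom tc (Ial i Ii)); rewrite (iso_in_im sMS sRS isoR).
    apply/subsetP=> _ /imsetP[x Mx ->]; have Nx := subsetP sMN x Mx.
    by rewrite inE Sb //= alc //; case/setIdP: Mx => _ /eqP->.
  have F2 : F M S (f^~ (i :* al) \o b) by apply: hom_comp FR; case: isoR.
  have Qai q : q \in Q -> (a i)^-1 q \in Q.
    move=> Qq; have [_ Aai] := rcosets_memE Ii (tc_mem tc Ii).
    have Aai1 : (a i)^-1 \in AutF F Q by apply: (groupVr (G := A)).
    exact: hom_Q sQS sSS (subxx Q) (AutF_hom Aai1) _ Qq.
  have eq12 : {in Q, conjg^~ g \o f^~ i =1 f^~ (i :* al) \o b}.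
    move=> q Qq /=; have Qbq : b q \in Q by apply: hom_Q sNS sSS sQN Fb _ Qq.
    rewrite (tc_Q tc) // (tc_Q tc) ?Ial // bal //.
    apply: (@perm_inj _ (a (i :* al))); rewrite permKV -[_ ^ g]conj_autEQ ?Qai //.
    by rewrite -permM -gE permM permKV.
  have [z Zz zE] := hom_unique sMS sQM F1 F2 eq12.
  have Sz := subsetP sZS z Zz.
  (* Replacing g by g z gives equality on the stabilizer and keeps the relation a_i al = c_g a_(i
     al), because c_z = 1. *)
  exists (g * z); split=> // [||x Mx]; first exact: groupM.
    by rewrite conj_autM // (conj_aut1P Sz Zz) mulg1.
  by rewrite conjgM -zE.
pose o := orbit_rep N; pose t := orbit_trans N.
have tN i : t i \in N by case: (orbit_transP sNS i).
have tS i : t i \in S by apply: (subsetP sNS).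
have tE i : o i :* c (t i) = i by case: (orbit_transP sNS i).
have oI i : i \in I -> o i \in I by move=> Ii; apply: (orbit_rep_in sNS).
have oM i s : s \in N -> o (i :* c s) = o i by move=> Ss; apply: orbit_rep_mul.
have otS i : i \in I -> f (t i) (o i) \in S by move=> Ii; rewrite (tc_S tc) ?oI.
(* This value is forced by the last relation for x = t i at the coset [o i], with h as the witness
   there. *)
exists (fun i => (f (t i) (o i))^-1 * h (o i) * f (b (t i)) (o i :* al)).
split=> [i Ii | i Ii | x i Nx Ii].
- have [Sh _ _] := hP _ (oI i Ii).
  by rewrite !groupM ?groupV ?(tc_S tc) ?Sb ?Ial ?oI.
- have [Sh hE _] := hP _ (oI i Ii).
  have alE : o i :* al :* c (b (t i)) = i :* al by rewrite alc // tE.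
  have bc : a (o i :* al) * c (b (t i)) = c (f (b (t i)) (o i :* al)) * a (i :* al).
    by rewrite (tc_conj tc) ?Sb ?Ial ?oI // alE.
  have oc : a (o i) * c (t i) = c (f (t i) (o i)) * a i.
    by rewrite (tc_conj tc) ?oI // tE.
  have Sbt : f (b (t i)) (o i :* al) \in S by rewrite (tc_S tc) ?Sb ?Ial ?oI.
  have Sf1 : (f (t i) (o i))^-1 \in S by rewrite groupV otS.
  rewrite !conj_autM ?groupM // -(mulgA _ _ (a _)) -bc !mulgA -(mulgA _ (c (h _))).
  rewrite -hE -!mulgA -(AutF_conj_hom sNS sQN Fb) // (mulgA (a _)) oc !mulgA.
  by rewrite -conj_autM ?otS // mulVg morph1 mul1g.
- rewrite oM //; set u := t (i :* c x); set n := t i * x * u^-1.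
  have [Sh hE hJ] := hP _ (oI i Ii).
  have Nn : n \in stab N (o i) by apply: orbit_trans_stab.
  have [Nn' /eqP no] := setIdP Nn.
  have [Nu St Sx] : [/\ u \in N, t i \in S & x \in S] by split; rewrite ?(subsetP sNS) //; apply: tN.
  have Su := subsetP sNS u Nu; have Sn := subsetP sNS n Nn'.
  have txE : t i * x = n * u by rewrite mulgKV.
  (* Since t i * x = n * u with n in the stabilizer of [o i], the cocycle identity is expanded along
     both factorizations, before and after b, and h relates the two values at n. *)
  have f1 : f (t i) (o i) * f x i = f n (o i) * f u (o i).
    have := tc_mul tc St Sx (oI i Ii); rewrite tE => <-.
    by rewrite txE (tc_mul tc) ?oI // no.
  have f2 : f (b (t i)) (o i :* al) * f (b x) (i :* al) =
            f (b n) (o i :* al) * f (b u) (o i :* al).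
    have Io := Ial _ (oI i Ii).
    have := tc_mul tc (Sb _ (tN i)) (Sb _ Nx) Io; rewrite alc // tE => <-.
    by rewrite -bM // txE bM // (tc_mul tc) ?Sb // alc // no.
  have f3 : f n (o i) * h (o i) = h (o i) * f (b n) (o i :* al).
    by rewrite -hJ // conjgC.
  apply: (mulgI (f (t i) (o i))); rewrite !mulgA mulgV mul1g f1 mulgK f3.
  by rewrite -!mulgA f2.
Qed.

(** * Construction of the model *)

Section Model.

Variables (a : {set {perm gT}} -> {perm gT}) (f : gT -> {set {perm gT}} -> gT).
Hypothesis tc : transversal_cocycle a f.

Local Notation wT := (regular_wreath {perm gT} gT).
Local Notation cZ := (center_abelian Q).

(* This is the group Gamma; norm_sum is the norm map, written additively, and
   norm_ker is its kernel on the elements that lie over 1. *)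
Definition lift_set : {set wT} :=
  [set w : wT | (w.1 \in AutF F Q) &&
     [forall i, if i \in I then (w.2 i \in S) && (a i * w.1 == c (w.2 i) * a (i :* w.1))
                else w.2 i == 1]].

Lemma lift_setP (w : wT) :
  reflect [/\ w.1 \in AutF F Q, {in I, forall i, w.2 i \in S},
              {in I, forall i, a i * w.1 = c (w.2 i) * a (i :* w.1)}
            & forall i, i \notin I -> w.2 i = 1]
          (w \in lift_set).
Proof.
rewrite [w \in _]in_set; apply: (iffP andP) => [[Aw /forallP Hw] | [Aw Sw Ew Ow]]; split=> //.
- by move=> i Ii; have := Hw i; rewrite Ii => /andP[].
- by move=> i Ii; have := Hw i; rewrite Ii => /andP[_ /eqP].
- by move=> i /negPf nIi; have := Hw i; rewrite nIi => /eqP.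
apply/forallP=> i; case: ifPn => [Ii | /Ow/eqP //].
by rewrite Sw // Ew // eqxx.
Qed.

Lemma rcosets_mulE i b : b \in AutF F Q -> (i :* b \in I) = (i \in I).
Proof.
move=> Ab; apply/idP/idP=> [Iib|Ii]; last exact: rcosets_mul.
rewrite -[i]rcoset1 -(mulgV b) rcosetM; apply: rcosets_mul => //.
exact: (groupVr (G := A)).
Qed.

Lemma lift_group_set : group_set lift_set.
Proof.
apply/group_setP; split=> [|w v /lift_setP[Aw Sw Ew Ow] /lift_setP[Av Sv Ev Ov]].
  apply/lift_setP; split=> [|i _|i _|i _]; rewrite ?ffunE ?(group1 A) //.
  by rewrite /= morph1 mulg1 mul1g rcoset1.
apply/lift_setP; split=> [|i Ii|i Ii|i nIi]; rewrite ?wreath_sndM ?wreath_fstM.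
- exact: (groupM (G := A)).
- by rewrite groupM ?Sw ?Sv ?rcosets_mulE.
- by rewrite conj_autM ?Sw ?Sv ?rcosets_mulE // mulgA Ew // -mulgA Ev ?rcosets_mulE // mulgA rcosetM.
- by rewrite Ow // Ov ?rcosets_mulE // mul1g.
Qed.
Canonical lift_group := group lift_group_set.

Definition norm_sum (w : wT) : FiniteModule.fmod_of cZ :=
  (\sum_(i in I) FiniteModule.fmod cZ (a i (w.2 i)))%R.

Lemma AutF_center b z : b \in AutF F Q -> z \in 'Z(Q) -> b z \in 'Z(Q).
Proof. by move=> Ab Zz; apply: (hom_center sQS (subxx S) (subxx Q) (AutF_hom Ab)). Qed.

Lemma tc_AutF i : i \in I -> a i \in AutF F Q.
Proof. by move=> Ii; case: (rcosets_memE Ii (tc_mem tc Ii)). Qed.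

Lemma lift_ker_center w : w \in lift_set -> w.1 = 1 -> {in I, forall i, w.2 i \in 'Z(Q)}.
Proof.
case/lift_setP=> _ Sw Ew _ w1 i Ii; have := Ew i Ii; rewrite w1 mulg1 rcoset1.
rewrite -{1}[a i]mul1g => /mulIg cw.
by apply/(conj_aut1P (Sw i Ii)).
Qed.

Lemma lift_ker_value_center w : w \in lift_set -> w.1 = 1 ->
  {in I, forall i, a i (w.2 i) \in 'Z(Q)}.
Proof. by move=> Lw w1 i Ii; rewrite AutF_center ?tc_AutF ?lift_ker_center. Qed.

Lemma norm_sumM w v : w \in lift_set -> v \in lift_set -> w.1 = 1 -> v.1 = 1 ->
  norm_sum (w * v) = (norm_sum w + norm_sum v)%R.
Proof.
move=> Lw Lv w1 v1; rewrite -big_split; apply: eq_bigr => i Ii /=.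
rewrite -FiniteModule.fmodM ?lift_ker_value_center //; congr (FiniteModule.fmod _ _).
rewrite wreath_sndM w1 rcoset1.
have [aM _ _] := hom_inj sQS (subxx S) (AutF_hom (tc_AutF Ii)).
by rewrite aM // (subsetP (center_sub Q)) ?lift_ker_center.
Qed.

(** Conjugation by v moves the coordinate w_i to the index i v.1 and turns it into w_i ^ v_i. Since
    a_i v.1 = c_(v_i) a_(i v.1), the new summand at i v.1 is the image under v.1 of the old summand
    at i. *)
Lemma norm_sumJ w v : w \in lift_set -> v \in lift_set -> w.1 = 1 ->
  FiniteModule.fmval (norm_sum (w ^ v)) = v.1 (FiniteModule.fmval (norm_sum w)).
Proof.
move=> Lw Lv w1; have [Av Sv Ev _] := lift_setP _ Lv.
have Lwv : w ^ v \in lift_set by rewrite (groupJ (G := lift_group)).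
have wv1 : (w ^ v).1 = 1 by rewrite conjgE !wreath_fstM w1 mul1g mulVg.
have wvE i : i \in I -> (w ^ v).2 (i :* v.1) = w.2 i ^ v.2 i.
  have E : (w * v).2 i = v.2 i * (w ^ v).2 (i :* v.1).
    by rewrite (conjgC w v) wreath_sndM.
  rewrite wreath_sndM w1 rcoset1 in E.
  by move=> _; apply: (mulgI (v.2 i)); rewrite -E; apply: conjgC.
rewrite /norm_sum (reindex_onto (fun i => i :* v.1) (fun i => i :* v.1^-1)) /=; last first.
  by move=> i _; rewrite -rcosetM mulVg rcoset1.
rewrite (eq_bigl (mem I)) => [|i]; last first.
  by rewrite rcosets_mulE // -rcosetM mulgV rcoset1 eqxx andbT.
have [vM _ _] := hom_inj sQS (subxx S) (AutF_hom Av).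
elim/big_rec2: _ => [|i x y Ii IH].
  by apply/esym/(mulgI (v.1 1)); rewrite -vM ?group1 // !mulg1.
have fA (u u' : FiniteModule.fmod_of cZ) :
  FiniteModule.fmval (u + u')%R = FiniteModule.fmval u * FiniteModule.fmval u' by [].
have fQ (u : FiniteModule.fmod_of cZ) : FiniteModule.fmval u \in Q.
  exact: subsetP (center_sub Q) _ (FiniteModule.fmodP u).
rewrite !fA IH vM //.
congr (_ * _); rewrite !FiniteModule.fmodK ?lift_ker_value_center ?rcosets_mulE //.
  rewrite wvE // -permM Ev // permM conj_autEQ ?Sv //.
  by rewrite (subsetP (center_sub Q)) ?lift_ker_center.
by have := lift_ker_value_center Lwv wv1; apply; rewrite rcosets_mulE.
Qed.

Definition norm_ker := [set w in lift_set | (w.1 == 1) && (norm_sum w == 0%R)].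

Lemma norm_ker_group_set : group_set norm_ker.
Proof.
apply/group_setP; split=> [|w v].
  rewrite inE (group1 lift_group) eqxx; apply/eqP; apply: big1 => i Ii.
  rewrite ffunE (_ : a i 1 = 1) ?FiniteModule.fmod1 //.
  have [aM _ _] := hom_inj sQS (subxx S) (AutF_hom (tc_AutF Ii)).
  by apply: (mulgI (a i 1)); rewrite -aM ?group1 // !mulg1.
case/setIdP=> Lw /andP[/eqP w1 /eqP w0] /setIdP[Lv /andP[/eqP v1 /eqP v0]].
rewrite inE (groupM (G := lift_group)) // norm_sumM // w0 v0 GRing.addr0.
by rewrite wreath_fstM w1 v1 mulg1 !eqxx.
Qed.
Canonical norm_ker_group := group norm_ker_group_set.

Lemma norm_ker_normal : norm_ker <| lift_group.
Proof.
apply/andP; split; first by apply/subsetP=> w; case/setIdP.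
apply/subsetP=> v Lv; rewrite inE; apply/subsetP=> _ /imsetP[w /setIdP[Lw] /andP[/eqP w1 /eqP w0] ->].
have [Av _ _ _] := lift_setP _ Lv.
rewrite in_set (groupJ (G := lift_group)) // conjgE !wreath_fstM w1 mul1g mulVg eqxx /=.
rewrite -conjgE; apply/eqP/FiniteModule.fmod_inj; rewrite norm_sumJ // w0.
have [vM _ _] := hom_inj sQS (subxx S) (AutF_hom Av).
by apply: (mulgI (v.1 1)); rewrite -vM ?group1 // !mulg1.
Qed.

Definition lift_emb (s : gT) : wT := (c s, [ffun i => if i \in I then f s i else 1]).

Lemma lift_embE s i : i \in I -> (lift_emb s).2 i = f s i.
Proof. by move=> Ii; rewrite ffunE Ii. Qed.

Lemma lift_emb_in s : s \in S -> lift_emb s \in lift_set.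
Proof.
move=> Ss; apply/lift_setP; split=> [|i Ii|i Ii|i nIi] /=; first exact: conj_aut_AutF.
- by rewrite lift_embE ?(tc_S tc).
- by rewrite ffunE Ii (tc_conj tc).
- by rewrite ffunE (negPf nIi).
Qed.

Lemma lift_embM : {in S &, {morph lift_emb : x y / x * y}}.
Proof.
move=> s t Ss St; apply: wreath_eqP; first exact: conj_autM.
move=> i; rewrite wreath_sndM !ffunE rcosets_mulE ?conj_aut_AutF //.
by case: ifP => [Ii | _]; rewrite ?mulg1 ?(tc_mul tc).
Qed.
Canonical lift_emb_morphism := Morphism lift_embM.

(** The first two properties of the witness of [transversal_cocycle_twist] say that w lies in Gamma;
    the third says, coordinate by coordinate, that x w = w b(x) after embedding. *)
Lemma lift_twist (N : {group gT}) b al : N \subset S -> Q \subset N -> F N S b ->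
    al \in AutF F Q -> {in Q, b =1 al} ->
  exists2 w, w \in lift_set & {in N, forall x, lift_emb x ^ w = lift_emb (b x)}.
Proof.
move=> sNS sQN Fb Aal bal.
have [g [Sg gE gJ]] := transversal_cocycle_twist tc sNS sQN Fb Aal bal.
have [_ _ Sb] := hom_inj sNS (subxx S) Fb.
pose w : wT := (al, [ffun i => if i \in I then g i else 1]).
exists w.
  apply/lift_setP; split=> [//|i Ii|i Ii|i nIi] /=; rewrite ffunE ?Ii ?Sg ?gE //.
  by rewrite (negPf nIi).
move=> x Nx; apply: (mulgI w); rewrite -conjgC; apply: wreath_eqP.
  exact: AutF_conj_hom sNS sQN Fb Aal bal Nx.
move=> i; rewrite !wreath_sndM !ffunE !rcosets_mulE ?conj_aut_AutF ?(subsetP sNS) //.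
by case: ifP => // Ii; rewrite gJ.
Qed.

(** Each q fixes all the cosets and has coordinates a_i^-1 q, so the identity reduces to a_i w.1 =
    c_(w_i) a_(i w.1). *)
Lemma lift_embJ w q : w \in lift_set -> q \in Q -> lift_emb q ^ w = lift_emb (w.1 q).
Proof.
move=> Lw Qq; have [Aw Sw Ew Ow] := lift_setP _ Lw.
have Qwq : w.1 q \in Q by apply: (hom_Q sQS (subxx S) (subxx Q) (AutF_hom Aw)).
have Fw := AutF_hom Aw.
apply: (mulgI w); rewrite -conjgC; apply: wreath_eqP.
  exact: (AutF_conj_hom sQS (subxx Q) Fw Aw (fun _ _ => erefl) Qq).
move=> i; rewrite !wreath_sndM !ffunE !rcosets_mulE ?conj_aut_AutF ?(subsetP sQS) //.
case: ifPn => [Ii | nIi]; last first.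
  by rewrite !Ow // rcosets_mulE ?conj_aut_AutF ?(subsetP sQS).
have Iw : i :* w.1 \in I by rewrite rcosets_mulE.
have -> : i :* c q = i.
  by have /subsetP/(_ q Qq) := sub_stab Ii sQS; rewrite inE => /andP[_ /eqP].
rewrite !(tc_Q tc) //.
have Qai : (a i)^-1 q \in Q.
  have Aai1 : (a i)^-1 \in AutF F Q by rewrite (groupVr (G := A)) ?tc_AutF.
  exact: hom_Q sQS (subxx S) (subxx Q) (AutF_hom Aai1) _ Qq.
rewrite conjgC; congr (_ * _); apply: (@perm_inj _ (a (i :* w.1))).
by rewrite permKV -[_ ^ _]conj_autEQ ?Sw // -permM -Ew // permM permKV.
Qed.

Lemma coprime_center_index : coprime #|'Z(Q)| #|I|.
Proof.
have pZ : p.-group 'Z(Q) := pgroupS sZS pS.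
apply: (pnat_coprime pZ).
by have [_ _] := and3P Sylow_AutS.
Qed.

Lemma norm_sum_emb z : z \in 'Z(Q) ->
  norm_sum (lift_emb z) = (FiniteModule.fmod cZ z *+ #|I|)%R.
Proof.
move=> Zz; rewrite -GRing.sumr_const; apply: eq_bigr => i Ii.
rewrite lift_embE // (tc_Q tc) ?permKV //.
exact: subsetP (center_sub Q) _ Zz.
Qed.

(** Such an s lies in Z(Q) and its norm is s^|I|, with |I| prime to |Z(Q)|. *)
Lemma lift_emb_ker s : s \in S -> lift_emb s \in norm_ker -> s = 1.
Proof.
move=> Ss /setIdP[_ /andP[/eqP cs1 /eqP ns0]].
have Zs : s \in 'Z(Q) by apply/conj_aut1P.
have := congr1 (@FiniteModule.fmval _ _ cZ) ns0; rewrite norm_sum_emb //.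
rewrite FiniteModule.fmvalZ FiniteModule.fmodK // => sn1.
rewrite -(expgK coprime_center_index Zs) /=.
by rewrite sn1 expg1n.
Qed.

(** Together with [lift_emb_ker], this identifies the elements over 1, modulo the norm kernel, with
    Z(Q). *)
Lemma lift_ker_emb w : w \in lift_set -> w.1 = 1 ->
  exists2 z, z \in 'Z(Q) & (lift_emb z)^-1 * w \in norm_ker.
Proof.
move=> Lw w1; pose u := FiniteModule.fmval (norm_sum w).
have Zu : u \in 'Z(Q) := FiniteModule.fmodP (norm_sum w).
(* The |I|-th root in Z(Q) of the norm of w, so that the image of z has the same norm as w. *)
pose z := u ^+ expg_invn 'Z(Q) #|I|.
have Zz : z \in 'Z(Q) by rewrite groupX.
have Sz := subsetP sZS z Zz.
have zn : z ^+ #|I| = u.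
  rewrite -expgM mulnC expgM.
  exact: (expgK coprime_center_index Zu).
exists z => //.
have Lz : lift_emb z^-1 \in lift_set by rewrite lift_emb_in ?groupV.
have z1 : (lift_emb z^-1).1 = 1 by apply/(conj_aut1P (groupVr Sz)); rewrite groupV.
rewrite -(morphV lift_emb_morphism) //= in_set (groupM (G := lift_group)) //.
rewrite wreath_fstM z1 w1 mulg1 eqxx norm_sumM //= norm_sum_emb ?groupV //.
rewrite FiniteModule.fmodV GRing.mulNrn -FiniteModule.fmodX // zn.
by rewrite FiniteModule.fmvalK GRing.addNr.
Qed.

(** * The quotient of Gamma by the norm kernel *)

Definition model_emb s := coset norm_ker (lift_emb s).

Lemma lift_norm : lift_set \subset 'N(norm_ker).
Proof. exact: normal_norm norm_ker_normal. Qed.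

Lemma model_embM : {in S &, {morph model_emb : x y / x * y}}.
Proof.
move=> s t Ss St; rewrite /model_emb lift_embM //.
by rewrite (morphM (coset_morphism norm_ker)) ?(subsetP lift_norm) ?lift_emb_in.
Qed.
Canonical model_emb_morphism := Morphism model_embM.

Lemma model_emb_inj : 'injm model_emb.
Proof.
apply/subsetP=> s /morphpreP[Ss /set1P]; rewrite inE => s1.
apply/eqP/lift_emb_ker => //.
by apply: coset_idr s1; rewrite (subsetP lift_norm) ?lift_emb_in.
Qed.

(** H contains every element of Gamma over 1, so its index is that of its image in Aut_F(Q), and
    this image contains the Sylow subgroup Aut_S(Q). *)
Lemma model_Sylow : p.-Sylow(lift_set / norm_ker) (model_emb @* S).
Proof.
pose H := (lift_emb @* S <*> norm_ker)%G.
have sSL : lift_emb @* S \subset lift_set.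
  by apply/subsetP=> _ /morphimP[s _ Ss ->]; apply: lift_emb_in.
have sNL : norm_ker \subset lift_set := normal_sub norm_ker_normal.
have sHL : H \subset lift_set by rewrite join_subG sSL.
have defS : model_emb @* S = H / norm_ker.
  rewrite quotientYidr ?(subset_trans sSL lift_norm) //.
  apply/setP=> x; apply/morphimP/morphimP=> [[s _ Ss ->] | [w Nw /morphimP[s _ Ss defw] ->]].
    by exists (lift_emb s); rewrite ?mem_morphim ?(subsetP lift_norm) ?lift_emb_in.
  by exists s; rewrite ?defw.
pose fstm := @Morphism wT _ setT _ (in2W (@wreath_fstM {perm gT} gT)).
have imL : fstm @* lift_set = AutF F Q.
  apply/setP=> al; apply/morphimP/idP=> [[w _ /lift_setP[Aw _ _ _] -> //] | Aal].
  have Fal : F Q S al := AutF_hom Aal.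
  (* Twisting with N = Q already produces an element of Gamma over al. *)
  have [g [Sg gE _]] := transversal_cocycle_twist tc sQS (subxx Q) Fal Aal (fun _ _ => erefl).
  pose w : wT := (al, [ffun i => if i \in I then g i else 1]).
  exists w => //; apply/lift_setP; split=> // i; rewrite ffunE; last by move/negPf->.
    by move=> Ii; rewrite Ii Sg.
  by move=> Ii; rewrite Ii gE.
have imH : AutG S Q \subset fstm @* H.
  rewrite AutG_conj_aut; apply/subsetP=> _ /morphimP[s _ Ss ->].
  apply/morphimP; exists (lift_emb s) => //.
  by apply: (subsetP (joing_subl _ _)); apply: mem_morphim.
have kerH : 'ker_lift_set fstm \subset H.
  apply/subsetP=> w /setIP[Lw /mker w1].
  have [z Zz Kzw] := lift_ker_emb Lw w1.
  rewrite -(mulKVg (lift_emb z) w) groupM //.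
    apply: (subsetP (joing_subl _ _)); apply: mem_morphim; exact: (subsetP sZS).
  exact: (subsetP (joing_subr _ _)).
have iLH : #|lift_set : H| = #|AutF F Q : fstm @* H|.
  rewrite -imL -(index_morphim_ker (G := lift_group) (H := H) fstm sHL (subsetT _)).
  by rewrite -(indexgI _ H) (setIidPl kerH) indexgg muln1.
rewrite defS; apply/and3P; split; first exact: quotientS.
  by rewrite -defS morphim_pgroup.
apply: pnat_dvd (index_quotient _) _.
  by rewrite subIset // lift_norm.
rewrite iLH; have [_ _] := and3P Sylow_AutS; apply: pnat_dvd.
by apply: (indexgS A).
Qed.

End Model.

(** Meeting point of the two halves: the quotient of Gamma has these properties, they imply that F
    is realized, and every realization has them ([realizes_model]), so uniqueness need only be
    proved for models. *)
Record model (hT : finGroupType) (G : {group hT}) (iota : {morphism S >-> hT}) : Prop := Model {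
  model_injm : 'injm iota;
  model_pHall : p.-Sylow(G) (iota @* S);
  model_act : {in G, forall g, exists2 al, al \in AutF F Q &
                {in Q, forall q, iota q ^ g = iota (al q)}};
  model_cent : {in G, forall g, {in Q, forall q, iota q ^ g = iota q} ->
                exists2 z, z \in 'Z(Q) & g = iota z};
  model_ext : forall (N : {group gT}) b, N \subset S -> Q \subset N -> F N S b ->
                exists2 g, g \in G & {in N, forall x, iota x ^ g = iota (b x)}
}.

Lemma hom_restrictQ (N : {group gT}) b : N \subset S -> Q \subset N -> F N S b ->
  exists2 al, al \in AutF F Q & {in Q, b =1 al}.
Proof.
move=> sNS sQN Fb.
have FbQ : F Q Q b.
  apply: (hom_narrow sQS (subxx S) sQS); first exact: hom_restrict Fb.
  exact: (hom_Q sNS (subxx S) sQN Fb).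
have [al Aal alE] := hom_AutF sQS FbQ.
by exists al => // q Qq; rewrite alE.
Qed.

Lemma model_exists : exists (hT : finGroupType) (G : {group hT})
  (iota : {morphism S >-> hT}), model G iota.
Proof.
have [a [f tc]] := transversal_cocycle_exists.
pose L := norm_ker_group tc.
exists (coset_of L), (lift_group a / L)%G, (model_emb_morphism tc).
have nL := lift_norm tc.
have embS s : s \in S -> lift_emb f s \in 'N(L).
  by move=> Ss; rewrite (subsetP nL) // lift_emb_in.
split; [exact: model_emb_inj | exact: model_Sylow | | |].
- move=> _ /morphimP[w Nw Lw ->]; have [Aw _ _ _] := lift_setP _ _ Lw.
  exists w.1 => // q Qq; rewrite /= /model_emb -(lift_embJ tc) //.
  by rewrite morphJ // embS // (subsetP sQS).
- move=> _ /morphimP[w Nw Lw ->] cw; have [Aw _ _ _] := lift_setP _ _ Lw.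
  have w1 : w.1 = 1.
    apply: (eq_Aut (A := Q)) => [||q Qq]; rewrite ?group1 //; first by case/setIdP: Aw.
    have Qwq : w.1 q \in Q by apply: (hom_Q sQS (subxx S) (subxx Q) (AutF_hom Aw)).
    rewrite perm1; apply: (injmP (model_emb_inj tc)); rewrite ?(subsetP sQS) //=.
    rewrite -[RHS](cw q Qq) /= /model_emb -(lift_embJ tc) // morphJ //.
    by rewrite embS // (subsetP sQS).
  have [z Zz Kw] := lift_ker_emb tc Lw w1.
  exists z => //; rewrite /= /model_emb -[w in LHS](mulKVg (lift_emb f z)).
  have Nz : lift_emb f z \in 'N(L) by rewrite embS // (subsetP sZS).
  have NK : (lift_emb f z)^-1 * w \in 'N(L) by rewrite groupM ?groupV.
  by rewrite morphM // [X in _ * X]coset_id // mulg1.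
- move=> N b sNS sQN Fb; have [al Aal bal] := hom_restrictQ sNS sQN Fb.
  have [w Lw wE] := lift_twist tc sNS sQN Fb Aal bal.
  exists (coset L w); first by rewrite mem_morphim // (subsetP nL).
  move=> x Nx; rewrite /= /model_emb -wE // morphJ ?embS ?(subsetP sNS) //.
  by rewrite (subsetP nL).
Qed.

(** * Models realize F *)

Lemma model_normal (hT : finGroupType) (G : {group hT}) (iota : {morphism S >-> hT}) :
  model G iota -> iota @* Q <| G.
Proof.
move=> mG; apply/andP; split.
  exact: subset_trans (morphimS _ sQS) (pHall_sub (model_pHall mG)).
apply/subsetP=> g Gg; rewrite inE; apply/subsetP=> _ /imsetP[_ /morphimP[q Sq Qq ->] ->].
have [al Aal ->] := model_act mG Gg; last by [].
have Qalq : al q \in Q by apply: (hom_Q sQS (subxx S) (subxx Q) (AutF_hom Aal)).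
by rewrite mem_morphim ?(subsetP sQS).
Qed.

Lemma model_centQ (hT : finGroupType) (G : {group hT}) (iota : {morphism S >-> hT}) :
  model G iota -> 'C_G(iota @* Q) \subset iota @* 'Z(Q).
Proof.
move=> mG; apply/subsetP=> g /setIP[Gg /centP cg].
have [q Qq|z Zz ->] := model_cent mG Gg.
  by apply/conjg_fixP/commgP/commute_sym/cg; rewrite mem_morphim ?(subsetP sQS).
by rewrite mem_morphim // (subsetP sZS).
Qed.

(** From F to G, f is first extended to PQ by normality of Q. Conversely, if f is conjugation by g,
    saturation extends the action of g on Q to psi on PQ. Some g' in G induces psi and agrees with g
    on Q, hence differs from g by an element of Z(Q), and f is a conjugation by an element of Z(Q)
    followed by psi. *)
Lemma model_fusion (hT : finGroupType) (G : {group hT}) (iota : {morphism S >-> hT})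
    (P R : {group gT}) f (f' : hT -> hT) : model G iota ->
    P \subset S -> R \subset S -> {in P, forall x, f x \in R} ->
    {in P, forall x, f' (iota x) = iota (f x)} ->
  F P R f = conj_hom G (iota @* P) (iota @* R) f'.
Proof.
move=> mG sPS sRS PRf f'E; have [_ nQF] := nQ.
have SR x : x \in P -> f x \in S by move=> Px; rewrite (subsetP sRS) ?PRf.
have sPQS : P <*> Q \subset S by rewrite join_subG sPS.
have sRQS : R <*> Q \subset S by rewrite join_subG sRS.
have sQPQ : Q \subset P <*> Q := joing_subr _ _.
have sPPQ : P \subset P <*> Q := joing_subl _ _.
apply/idP/exists_inP=> [Ff | [g0 Gg0 /forall_inP H]].
  have [b [Fb fb _]] := nQF _ _ _ sPS sRS Ff.
  have [|g Gg gE] := model_ext mG sPQS sQPQ (b := b); first exact: (hom_widen sRQS).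
  exists g^-1; rewrite ?groupV //; apply/forall_inP=> _ /morphimP[x Sx Px ->].
  rewrite invgK f'E // mem_morphim ?SR ?PRf // andbT.
  by rewrite gE ?(subsetP sPPQ) // fb.
set g := g0^-1 in H *; have Gg : g \in G by rewrite groupV.
have [al Aal alE] := model_act mG Gg.
have QalQ q : q \in Q -> al q \in Q by apply: (hom_Q sQS (subxx S) (subxx Q) (AutF_hom Aal)).
have fE x : x \in P -> iota (f x) = iota x ^ g.
  move=> Px; rewrite -f'E //.
  by have /andP[/eqP] := H (iota x) (mem_morphim _ (subsetP sPS x Px) Px).
(* g sends P into S as f does, and Q into itself, hence PQ into S; this supplies the y required by
   [AutF_ext]. *)
have Sg x : x \in P <*> Q -> exists2 y, y \in S & iota x ^ g = iota y.
  rewrite norm_joinEl ?(subset_trans sPS) // => /mulsgP[u v Pu Qv ->].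
  have [Su Sv] := (subsetP sPS u Pu, subsetP sQS v Qv).
  have Salv : al v \in S by rewrite (subsetP sQS) ?QalQ.
  exists (f u * al v); first by rewrite groupM ?SR.
  by rewrite !morphM ?SR // conjMg -fE // alE.
have [x Nx|psi Fpsi psiE] := AutF_ext Aal sQPQ sPQS.
  have [y Sy yE] := Sg x Nx; exists y => // q Qq.
  have Sx := subsetP sPQS x Nx; have Sq := subsetP sQS q Qq.
  have Qqx : q ^ x \in Q by rewrite memJ_norm ?(subsetP nQS).
  have [Sal Salx] : al q \in S /\ al (q ^ x) \in S by split; rewrite (subsetP sQS) ?QalQ.
  apply: (injmP (model_injm mG)); rewrite ?groupJ //.
  by rewrite -alE // !morphJ // -alE // -yE -!conjJg.
have [g' Gg' g'E] := model_ext mG sPQS sQPQ Fpsi.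
have [||z Zz zE] := model_cent mG (x := g' * g^-1); first by rewrite groupM ?groupV.
  move=> q Qq; rewrite conjgM g'E ?(subsetP sQPQ) // psiE //.
  by rewrite -alE // conjgK.
have Sz := subsetP sZS z Zz.
have Qz := subsetP (center_sub Q) z Zz.
have gE : g = iota z^-1 * g' by rewrite morphV // -zE invMg invgK mulgKV.
have PQz x : x \in P -> x ^ z^-1 \in P <*> Q.
  by move=> Px; rewrite groupJ ?groupV ?(subsetP sPPQ x Px) ?(subsetP sQPQ z Qz).
have [_ _ Spsi] := hom_inj sPQS (subxx S) Fpsi.
have fpsi : {in P, f =1 psi \o conjg^~ z^-1}.
  move=> x Px /=; apply: (injmP (model_injm mG)); rewrite ?SR ?Spsi ?PQz //.
  by rewrite fE // gE conjgM -g'E ?PQz // morphJ ?groupV // (subsetP sPS).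
apply: (hom_narrow sPS (subxx S) sRS) PRf.
rewrite (@hom_ext _ _ F P S _ _ _ _ fpsi) //.
apply: (hom_comp sPS sPQS (subxx S) _ Fpsi).
by apply: hom_conjg; rewrite ?groupV.
Qed.

(** Normal subgroups N and R of coprime orders commute, so N lies in C_G(R), hence in R, which it
    meets trivially. *)
Lemma p'_reduced_of_cent (hT : finGroupType) (G R : {group hT}) :
  R <| G -> p.-group R -> 'C_G(R) \subset R -> p'_reduced p G.
Proof.
move=> nRG pR cR N nNG coN.
have pcN : coprime #|N| #|R|.
  by rewrite coprime_sym; apply: (pnat_coprime pR); rewrite p'natE // -prime_coprime.
have tiNR : N :&: R = 1 by apply: coprime_TIg.
have cNR : N \subset 'C(R).
  rewrite (sameP commG1P trivgP) -tiNR commg_subI // subsetI subxx /=.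
    exact: subset_trans (normal_sub nNG) (normal_norm nRG).
  exact: subset_trans (normal_sub nRG) (normal_norm nNG).
apply/trivgP; rewrite -tiNR subsetI subxx (subset_trans _ cR) // subsetI cNR.
by rewrite normal_sub.
Qed.

Lemma model_realizes (hT : finGroupType) (G : {group hT}) (iota : {morphism S >-> hT}) :
  model G iota -> realizes p F G iota.
Proof.
move=> mG; have nQG := model_normal mG.
have pQ : p.-group (iota @* Q) by rewrite morphim_pgroup // (pgroupS sQS).
have cQG : 'C_G(iota @* Q) \subset iota @* Q.
  exact: subset_trans (model_centQ mG) (morphimS _ (center_sub Q)).
have redG := p'_reduced_of_cent nQG pQ cQG.
apply: (Realizes (model_injm mG) (realizes_Sylow := model_pHall mG) redG).
  by split=> //; exists (iota @* Q)%G.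
by move=> P R f f' sPS sRS PRf f'E; apply: model_fusion.
Qed.

(** * Groups realizing F *)

Section RealizesModel.

Variables (hT : finGroupType) (G : {group hT}) (iota : {morphism S >-> hT}).
Hypothesis rG : realizes p F G iota.

Let inji := realizes_inj rG.
Let sylS := realizes_Sylow rG.
Let sSG := pHall_sub sylS.

Lemma realizes_fusionE (P R : {group gT}) f (f' : hT -> hT) :
    P \subset S -> R \subset S -> {in P, forall x, f x \in R} ->
    {in P, forall x, f' (iota x) = iota (f x)} ->
  F P R f = conj_hom G (iota @* P) (iota @* R) f'.
Proof. by move=> sPS sRS PRf f'E; apply: (realizes_fusion rG) f'E. Qed.

Lemma realizes_ext (N : {group gT}) b : N \subset S -> F N S b ->
  exists2 g, g \in G & {in N, forall x, iota x ^ g = iota (b x)}.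
Proof.
move=> sNS Fb; have [_ _ Sb] := hom_inj sNS (subxx S) Fb.
pose f' y := iota (b (invm inji y)).
have f'E : {in N, forall x, f' (iota x) = iota (b x)}.
  by move=> x Nx; rewrite /f' invmE // (subsetP sNS).
move: Fb; rewrite (realizes_fusionE sNS (subxx S) Sb f'E).
case/exists_inP=> g Gg /forall_inP H; exists g^-1; rewrite ?groupV // => x Nx.
have /andP[/eqP <- _] := H (iota x) (mem_morphim _ (subsetP sNS x Nx) Nx).
exact: f'E.
Qed.

Lemma realizes_conj (P : {group gT}) g : P \subset S -> g \in G ->
    {in P, forall x, iota x ^ g \in iota @* P} ->
  exists2 f, F P P f & {in P, forall x, iota x ^ g = iota (f x)}.
Proof.
move=> sPS Gg Pg; pose f x := invm inji (iota x ^ g).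
have fE : {in P, forall x, iota x ^ g = iota (f x)}.
  by move=> x Px; rewrite /f invmK // (subsetP (morphimS iota sPS)) ?Pg.
have PPf : {in P, forall x, f x \in P}.
  move=> x Px; have /morphimP[y Sy Py yE] := Pg x Px.
  by rewrite /f yE invmE.
exists f => //; rewrite (realizes_fusionE (f' := conjg^~ g) sPS sPS PPf fE).
apply/exists_inP; exists g^-1; rewrite ?groupV //; apply/forall_inP=> _ /morphimP[x Sx Px ->].
by rewrite invgK eqxx Pg.
Qed.

(* An element g of G acts on R as some h that normalizes Q, since Q is normal in
   F; then g h^-1 centralizes R, hence lies in R, and R normalizes Q. *)
Lemma realizes_normal : iota @* Q <| G.
Proof.
have [_ [R [nRG pR cR]]] := realizes_constrained rG.
have sRS : R \subset iota @* S.
  by apply: subset_trans (pcore_sub_Hall sylS); apply: pcore_max.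
pose R0 := (iota @*^-1 R)%G.
have imR0 : iota @* R0 = R by rewrite morphpreK.
have sR0S : R0 \subset S by apply: subsetIl.
apply/andP; split; first exact: subset_trans (morphimS _ sQS) sSG.
apply/subsetP=> g Gg; have [|f Ff fE] := realizes_conj sR0S Gg.
  move=> x Rx; rewrite imR0 memJ_norm ?(subsetP (normal_norm nRG)) //.
  by rewrite -imR0 mem_morphim // (subsetP sR0S).
have [_ nQF] := nQ; have [b [Fb fb bQ]] := nQF _ _ _ sR0S sR0S Ff.
have sRQS : R0 <*> Q \subset S by rewrite join_subG sR0S.
have [h Gh hE] := realizes_ext sRQS (hom_widen sRQS sRQS (subxx S) Fb).
have cgh : g * h^-1 \in R.
  apply: (subsetP cR); rewrite inE groupM ?groupV //=; apply/centP=> x.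
  rewrite -imR0 => /morphimP[y Sy Ry ->].
  apply/commute_sym/commgP/conjg_fixP; rewrite conjgM fE // -fb //.
  by rewrite -hE ?conjgK // (subsetP (joing_subl _ _)).
have nQgh : g * h^-1 \in 'N(iota @* Q).
  apply: (subsetP _ _ (subsetP sRS _ cgh)).
  exact: subset_trans (morphim_norms _ nQS) _.
rewrite -(mulgKV h g) groupM // inE; apply/subsetP=> _ /imsetP[_ /morphimP[q Sq Qq ->] ->].
rewrite hE ?(subsetP (joing_subr _ _)) //.
have Qbq : b q \in Q by rewrite -bQ imset_f.
by rewrite mem_morphim // (subsetP sQS).
Qed.

(* A p'-element y of C_G(Q) satisfies [R, y] <= C_R(Q) <= Z(Q), so that it acts
   trivially on R by coprimality. *)
Lemma realizes_cent : 'C_G(iota @* Q) \subset iota @* 'Z(Q).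
Proof.
have [_ [R [nRG pR cR]]] := realizes_constrained rG.
have sRS : R \subset iota @* S.
  by apply: subset_trans (pcore_sub_Hall sylS); apply: pcore_max.
pose C := 'C_G(iota @* Q)%G.
have nCG : C <| G.
  rewrite /= /normal subsetIl normsI ?normG //.
  exact: subset_trans (normal_norm realizes_normal) (cent_norm _).
have sCZ : C :&: iota @* S \subset iota @* 'Z(Q).
  apply/subsetP=> y /setIP[/setIP[_ /centP cx] /morphimP[x Sx _ xE]].
  rewrite xE mem_morphim // -centric_cent inE Sx; apply/centP=> q Qq.
  have Sq := subsetP sQS q Qq.
  apply: (injmP inji); rewrite ?groupM // !morphM // -xE.
  by apply: cx; rewrite mem_morphim.
(* A normal p-subgroup lies in the image of S, where centralizing Q means lying in Z(Q). *)
suff pC : p.-group C.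
  apply: subset_trans sCZ; rewrite subsetI subxx.
  by apply: subset_trans (pcore_sub_Hall sylS); apply: pcore_max.
pose D := (C :&: R)%G.
have sDQ : D \subset iota @* Q.
  apply: subset_trans (morphimS iota (center_sub Q)).
  by apply: subset_trans sCZ; apply: setIS.
apply/pgroupP=> r pr_r /(Cauchy pr_r)[y Cy oy].
(* Contraposition against a true statement: r is assumed different from p and an absurdity is
   sought. *)
apply: contraLR (isT) => neq_rp.
have co : coprime #|R| #|<[y]>|.
  rewrite -orderE oy; apply: (pnat_coprime pR).
  by rewrite pnatE.
have sYC : <[y]> \subset C by rewrite cycle_subG.
have sRYD : [~: R, <[y]>] \subset D.
  apply: subset_trans (commgS R sYC) _; rewrite subsetI commg_subr commg_subl.
  rewrite (subset_trans (normal_sub nRG) (normal_norm nCG)).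
  exact: subset_trans (normal_sub nCG) (normal_norm nRG).
have cRy : y \in 'C(R).
  apply/centP=> x Rx; apply/commute_sym/commgP.
  have Dz : [~ x, y] \in D by rewrite (subsetP sRYD) // mem_commg ?cycle_id.
  have cyz : commute y [~ x, y].
    by have /setIP[_ /centP cy] := Cy; apply: cy; rewrite (subsetP sDQ).
  (* y commutes with [x, y], so [x, y]^r = [x, y^r] = 1, whereas [x, y] lies in the p-group R. *)
  have zr : [~ x, y] ^+ r == 1 by rewrite -commgX // -oy expg_order commg1.
  rewrite -order_eq1 -dvdn1 -(eqP co) dvdn_gcd order_dvdG /=; last by case/setIP: Dz.
  by rewrite -[#|<[y]>|]/(#[y]) oy order_dvdn zr.
have Ry : y \in R.
  by apply: (subsetP cR); rewrite inE (subsetP (normal_sub nCG)).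
have : y \in R :&: <[y]> by rewrite inE Ry cycle_id.
by rewrite (coprime_TIg co) inE -order_eq1 oy gtn_eqF // prime_gt1.
Qed.

Lemma realizes_model : model G iota.
Proof.
split=> // [g Gg | g Gg cg | N b sNS sQN Fb]; last exact: realizes_ext.
  have [|f Ff fE] := realizes_conj sQS Gg.
    move=> q Qq; rewrite memJ_norm ?(subsetP (normal_norm realizes_normal)) //.
    by rewrite mem_morphim // (subsetP sQS).
  have [al Aal alE] := hom_AutF sQS Ff.
  by exists al => // q Qq; rewrite fE // alE.
have : g \in iota @* 'Z(Q).
  apply: (subsetP realizes_cent); rewrite inE Gg; apply/centP=> _ /morphimP[q _ Qq ->].
  by apply/commute_sym/commgP/conjg_fixP; apply: cg.
by case/morphimP=> z _ Zz ->; exists z.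
Qed.

End RealizesModel.

(** * Uniqueness *)

Section ModelUnique.

Variables (hT1 hT2 : finGroupType) (G1 : {group hT1}) (G2 : {group hT2}).
Variables (iota1 : {morphism S >-> hT1}) (iota2 : {morphism S >-> hT2}).
Hypotheses (m1 : model G1 iota1) (m2 : model G2 iota2).

Let sG1 := pHall_sub (model_pHall m1).
Let sG2 := pHall_sub (model_pHall m2).

Definition fiber_set : {set hT1 * hT2} :=
  [set w in setX G1 G2 | [exists al in AutF F Q, [forall q in Q,
     (iota1 q ^ w.1 == iota1 (al q)) && (iota2 q ^ w.2 == iota2 (al q))]]].

Lemma fiber_setP w :
  reflect [/\ w.1 \in G1, w.2 \in G2 & exists2 al, al \in AutF F Q &
             {in Q, forall q, iota1 q ^ w.1 = iota1 (al q) /\ iota2 q ^ w.2 = iota2 (al q)}]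
          (w \in fiber_set).
Proof.
case: w => w1 w2; apply: (iffP setIdP) => [[/setXP[G1w G2w] /exists_inP[al Aal /forall_inP H]]|[G1w G2w [al Aal H]]].
  by split=> //; exists al => // q /H/andP[/eqP-> /eqP->].
split; first exact/setXP.
apply/exists_inP; exists al => //; apply/forall_inP=> q /H[-> ->].
by rewrite !eqxx.
Qed.

Lemma AutF_Q al q : al \in AutF F Q -> q \in Q -> al q \in Q.
Proof. by move=> Aal; apply: (hom_Q sQS (subxx S) (subxx Q) (AutF_hom Aal)). Qed.

Lemma fiber_group_set : group_set fiber_set.
Proof.
apply/group_setP; split=> [|w v /fiber_setP[G1w G2w [al Aal alE]] /fiber_setP[G1v G2v [be Abe beE]]].
  apply/fiber_setP; split; rewrite ?group1 //; exists 1; first exact: (group1 A).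
  by move=> q Qq; rewrite perm1 !conjg1.
apply/fiber_setP; split; rewrite ?groupM //; exists (al * be); first exact: (groupM (G := A)).
move=> q Qq; have [e1 e2] := alE q Qq; have [e1' e2'] := beE _ (AutF_Q Aal Qq).
by rewrite !conjgM e1 e2 e1' e2' permM.
Qed.
Canonical fiber_group := group fiber_group_set.

Definition diag_emb s := (iota1 s, iota2 s).

Lemma diag_embM : {in S &, {morph diag_emb : x y / x * y}}.
Proof. by move=> x y Sx Sy; rewrite /diag_emb !morphM. Qed.
Canonical diag_emb_morphism := Morphism diag_embM.

Lemma diag_emb_in s : s \in S -> diag_emb s \in fiber_set.
Proof.
move=> Ss; apply/fiber_setP; split=> /=.
- by rewrite (subsetP sG1) ?mem_morphim.
- by rewrite (subsetP sG2) ?mem_morphim.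
exists (c s); first exact: conj_aut_AutF.
by move=> q Qq; rewrite conj_autEQ // !morphJ // (subsetP sQS).
Qed.

(** V is the kernel of the map from the fibre product to Aut_F(Q). *)
Let V := setX_group (iota1 @* 'Z(Q)) (iota2 @* 'Z(Q)).
Let K := (diag_emb @* 'Z(Q))%G.

Let Q_S q : q \in Q -> q \in S. Proof. exact: (subsetP sQS). Qed.
Let Z_S z : z \in 'Z(Q) -> z \in S. Proof. exact: (subsetP sZS). Qed.

Lemma mem_fiber_ker w : reflect
  (exists z1 z2, [/\ z1 \in 'Z(Q), z2 \in 'Z(Q) & w = (iota1 z1, iota2 z2)]) (w \in V).
Proof.
apply: (iffP idP) => [|[z1 [z2 [Zz1 Zz2 ->]]]]; last first.
  by apply/setXP; rewrite !mem_morphim ?Z_S.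
case: w => w1 w2 /setXP[/morphimP[z1 _ Zz1 ->] /morphimP[z2 _ Zz2 ->]].
by exists z1, z2.
Qed.

Lemma center_iotaJ (hT : finGroupType) (iota : {morphism S >-> hT}) z q :
  z \in 'Z(Q) -> q \in Q -> iota q ^ iota z = iota q.
Proof.
move=> Zz Qq; have qz : q ^ z = q.
  by apply/conjg_fixP/commgP/commute_sym; case/setIP: Zz => _ /centP; apply.
by rewrite -(morphJ iota (Q_S Qq) (Z_S Zz)) qz.
Qed.

Lemma sub_ker_fiber : V \subset fiber_set.
Proof.
apply/subsetP=> _ /mem_fiber_ker[z1 [z2 [Zz1 Zz2 ->]]].
apply/fiber_setP; split=> /=; rewrite ?(subsetP sG1) ?(subsetP sG2) ?mem_morphim ?Z_S //.
exists 1; first exact: (group1 A).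
by move=> q Qq; rewrite perm1 !center_iotaJ.
Qed.

(** Both coordinates act on Q by the same automorphism, so if one is trivial then both centralize Q.
    In particular V contains the kernels of the two projections. *)
Lemma fiber_ker w : w \in fiber_set -> (w.1 = 1 \/ w.2 = 1) -> w \in V.
Proof.
case: w => w1 w2 /fiber_setP[/= G1w G2w [al Aal alE]] w_1.
have al1 q : q \in Q -> al q = q.
  move=> Qq; have [e1 e2] := alE q Qq; have Sq := Q_S Qq; have Salq := Q_S (AutF_Q Aal Qq).
  case: w_1 => w1E.
    by apply: (injmP (model_injm m1)); rewrite // -e1 w1E conjg1.
  by apply: (injmP (model_injm m2)); rewrite // -e2 w1E conjg1.
have [q Qq|z1 Zz1 ->] := model_cent m1 G1w.
  by case: (alE q Qq) => -> _; rewrite al1.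
have [q Qq|z2 Zz2 ->] := model_cent m2 G2w.
  by case: (alE q Qq) => _ ->; rewrite al1.
by apply/mem_fiber_ker; exists z1, z2.
Qed.

Lemma diag_fiber_ker : V :&: diag_emb @* S \subset K.
Proof.
apply/subsetP=> w /setIP[/mem_fiber_ker[z1 [z2 [Zz1 _ ->]]] /morphimP[s _ Ss [e1 e2]]].
have Zs : s \in 'Z(Q).
  by rewrite -(injmP (model_injm m1) _ _ (Z_S Zz1) Ss e1).
apply/morphimP; exists s => //; by rewrite e1 e2.
Qed.

Lemma fiber_ker_normal : V <| fiber_set.
Proof.
apply/andP; split; first exact: sub_ker_fiber.
apply/subsetP=> w /fiber_setP[G1w G2w [al Aal alE]]; rewrite inE.
apply/subsetP=> _ /imsetP[_ /mem_fiber_ker[z1 [z2 [Zz1 Zz2 ->]]] ->].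
have ZQ z : z \in 'Z(Q) -> z \in Q by apply: (subsetP (center_sub Q)).
apply/mem_fiber_ker; exists (al z1), (al z2); rewrite !AutF_center //; split=> //.
by have [[<- _] [_ <-]] := (alE z1 (ZQ _ Zz1), alE z2 (ZQ _ Zz2)).
Qed.

Lemma diag_center_normal : K <| fiber_set.
Proof.
apply/andP; split.
  by apply/subsetP=> _ /morphimP[z Sz Zz ->]; apply: diag_emb_in.
apply/subsetP=> w /fiber_setP[G1w G2w [al Aal alE]]; rewrite inE.
apply/subsetP=> _ /imsetP[_ /morphimP[z Sz Zz ->] ->].
have ZQ : z \in Q by apply: (subsetP (center_sub Q)).
apply/morphimP; exists (al z); rewrite ?Z_S ?AutF_center //.
by rewrite /= /diag_emb; have [<- <-] := alE z ZQ.
Qed.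

Lemma fiber_im1 : fst @* fiber_set = G1.
Proof.
apply/setP=> g; apply/morphimP/idP=> [[w _ /fiber_setP[Gw _ _] ->] // | Gg].
have [al Aal alE] := model_act m1 Gg.
have Fal := AutF_hom Aal.
have [h Gh hE] := model_ext m2 sQS (subxx Q) Fal.
exists (g, h) => //; apply/fiber_setP; split=> //; exists al => // q Qq.
by rewrite /= alE // hE.
Qed.

Lemma fiber_im2 : snd @* fiber_set = G2.
Proof.
apply/setP=> g; apply/morphimP/idP=> [[w _ /fiber_setP[_ Gw _] ->] // | Gg].
have [al Aal alE] := model_act m2 Gg.
have Fal := AutF_hom Aal.
have [h Gh hE] := model_ext m1 sQS (subxx Q) Fal.
exists (h, g) => //; apply/fiber_setP; split=> //; exists al => // q Qq.
by rewrite /= alE // hE.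
Qed.

Lemma fiber_splits : [splits fiber_set / K, over V / K].
Proof.
have nVD := fiber_ker_normal; have nKD := diag_center_normal.
have sSD : diag_emb @* S \subset fiber_set.
  by apply/subsetP=> _ /morphimP[s _ Ss ->]; apply: diag_emb_in.
have sKV : K \subset V.
  apply/subsetP=> _ /morphimP[z Sz Zz ->]; apply/mem_fiber_ker; by exists z, z.
have pZ : p.-group 'Z(Q) := pgroupS sZS pS.
have pV : p.-group V by rewrite /pgroup cardsX pnatM; apply/andP; split; apply: morphim_pgroup.
have abV : abelian V.
  have abZ := center_abelian Q.
  apply/centsP=> _ /mem_fiber_ker[z1 [z2 [Zz1 Zz2 ->]]] _ /mem_fiber_ker[y1 [y2 [Zy1 Zy2 ->]]].
  congr (_, _).
    exact: (centsP (morphim_abelian iota1 abZ)) (mem_morphim _ (Z_S Zz1) Zz1) _ (mem_morphim _ (Z_S Zy1) Zy1).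
  exact: (centsP (morphim_abelian iota2 abZ)) (mem_morphim _ (Z_S Zz2) Zz2) _ (mem_morphim _ (Z_S Zy2) Zy2).
pose T := (V <*> diag_emb @* S)%G.
have sTD : T \subset fiber_set by rewrite join_subG (normal_sub nVD).
have sVT : V \subset T := joing_subl _ _.
have defT : V * diag_emb @* S = T.
  by rewrite /= norm_joinEr // (subset_trans sSD) ?normal_norm.
(* The kernel of the first projection lies in V, hence in T, so the index of T is that of its image
   in G1, which contains the Sylow subgroup [iota1 @* S]. *)
have p'iT : p^'.-nat #|fiber_set : T|.
  have kerT : 'ker_fiber_set fst \subset T.
    apply/subsetP=> w /setIP[Dw /mker w1]; apply: (subsetP sVT).
    by apply: fiber_ker => //; left.
  have := index_morphim_ker (G := fiber_group) (H := T) (fst_morphism hT1 hT2) sTD (subsetT _).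
  rewrite /= -(indexgI _ T) (setIidPl kerT) indexgg muln1 fiber_im1 => <-.
  have [_ _] := and3P (model_pHall m1); apply: pnat_dvd.
  apply: indexgS; apply/subsetP=> _ /morphimP[s _ Ss ->].
  apply/morphimP; exists (diag_emb s) => //.
  by apply: (subsetP (joing_subr _ _)); apply: mem_morphim.
rewrite (@Gaschutz_split _ (fiber_group / K)%G (V / K)%G (T / K)%G).
(* The diagonal copy of S meets V only inside K and generates T together with V. *)
- apply/splitsP; exists (diag_emb @* S / K)%G; apply/complP; split.
    rewrite /= -quotientIG ?morphimS ?sZS //; apply/trivgP.
    rewrite quotient_sub1 ?diag_fiber_ker //.
    apply: subset_trans (subsetIl _ _) _.
    exact: subset_trans (normal_sub nVD) (normal_norm nKD).
  rewrite /= -quotientMl ?defT // (subset_trans _ (normal_norm nKD)) //.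
  exact: normal_sub nVD.
- exact: quotient_normal.
- exact: quotientS.
- exact: quotientS.
- exact: quotient_abelian.
apply: (pnat_coprime (quotient_pgroup _ pV)); apply: pnat_dvd (index_quotient _) p'iT.
by rewrite subIset // normal_norm.
Qed.

Lemma model_isog : G1 \isog G2.
Proof.
have nVD := fiber_ker_normal; have nKD := diag_center_normal.
have /splitsP[B /complP[tiVB defD]] := fiber_splits.
have sBD : B \subset fiber_set / K by rewrite -defD mulG_subr.
have [T defB sKT sTD] := inv_quotientS nKD sBD.
have nKV : V \subset 'N(K) := subset_trans (normal_sub nVD) (normal_norm nKD).
have sKV : K \subset V.
  by apply/subsetP=> _ /morphimP[z Sz Zz ->]; apply/mem_fiber_ker; exists z, z.
have sVTK : V :&: T \subset K.
  rewrite -quotient_sub1 ?subIset ?nKV // quotientIG //.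
  by rewrite -defB tiVB.
have sDVT : fiber_set \subset V * T.
  rewrite -(mulSGid sKV) -mulgA -quotientSK ?normal_norm // quotientMl //.
  by rewrite -defB defD.
(* Such a w lies in V and in T, hence in the diagonal subgroup K, where one trivial coordinate
   forces the other; so both projections are injective on T. *)
have kerT w : w \in T -> w.1 = 1 \/ w.2 = 1 -> w = 1.
  move=> Tw w1; have Dw := subsetP sTD w Tw.
  have : w \in V :&: T by rewrite inE fiber_ker.
  move/(subsetP sVTK)/morphimP=> [z Sz Zz wE]; rewrite wE in w1 *.
  suff -> : z = 1 by apply: morph1.
  case: w1 => /= z1.
    by apply: (injmP (model_injm m1)); rewrite ?morph1.
  by apply: (injmP (model_injm m2)); rewrite ?morph1.
have isoT1 : T \isog G1.
  apply: (isog_of_trivial_ker (f := fst_morphism hT1 hT2)) => [w Tw w1|].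
    by apply: kerT => //; left.
  apply/eqP; rewrite -fiber_im1 eqEsubset morphimS //=.
  apply/subsetP=> _ /morphimP[w _ /(subsetP sDVT)/mulsgP[v t /mem_fiber_ker[z1 [z2 [Zz1 _ ->]]] Tt ->] ->].
  (* The first coordinate of an element of V is also that of an element of K, and K lies in T; so T
     already projects onto the image of V T. *)
  apply/morphimP; exists (diag_emb z1 * t) => //.
  by rewrite groupM // (subsetP sKT) // mem_morphim ?Z_S.
have isoT2 : T \isog G2.
  apply: (isog_of_trivial_ker (f := snd_morphism hT1 hT2)) => [w Tw w1|].
    by apply: kerT => //; right.
  apply/eqP; rewrite -fiber_im2 eqEsubset morphimS //=.
  apply/subsetP=> _ /morphimP[w _ /(subsetP sDVT)/mulsgP[v t /mem_fiber_ker[z1 [z2 [_ Zz2 ->]]] Tt ->] ->].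
  apply/morphimP; exists (diag_emb z2 * t) => //.
  by rewrite groupM // (subsetP sKT) // mem_morphim ?Z_S.
by apply: isog_trans isoT2; rewrite isog_sym.
Qed.

End ModelUnique.

End NormalCentric.

Unset Implicit Arguments.

Theorem proposition3 (p : nat) (gT : finGroupType) (S : {group gT})
    (F : fusion_system S) :
  prime p -> p.-group S -> saturated F p -> constrained F ->
  (exists (hT : finGroupType) (G : {group hT}) (iota : {morphism S >-> hT}),
     realizes p F G iota) /\
  (forall (hT1 hT2 : finGroupType) (G1 : {group hT1}) (G2 : {group hT2})
      (iota1 : {morphism S >-> hT1}) (iota2 : {morphism S >-> hT2}),
     realizes p F G1 iota1 -> realizes p F G2 iota2 -> G1 \isog G2).
Proof.
move=> pr_p pS satF [Q [_ cQ nQ]]; split.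
  have [hT [G [iota mG]]] := model_exists pS satF cQ nQ.
  by exists hT, G, iota; apply: model_realizes mG.
move=> hT1 hT2 G1 G2 iota1 iota2 r1 r2.
have m1 := realizes_model cQ nQ r1; have m2 := realizes_model cQ nQ r2.
exact: model_isog m1 m2.
Qed.
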